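(* Let $N$ be a positive integer, let $L_N=\{f\}$ be the language consisting of one unary function symbol, and let $\mathcal{T}_N$ be the $L_N$-theory stating that: $f$ is injective and the complement $M\setminus f(M)$ of its image is a finite set of exactly $N$ elements; and for every integer $n\geq 1$, $\forall x\; f^n(x)\neq x$, where $f^n$ is the $n$-th iterate of $f$. Then for every model $M$ of $\mathcal{T}_N$, the Grothendieck ring $K_0(M)$ is isomorphic to $(\mathbb{Z}/N\mathbb{Z})[X]$, via an isomorphism sending the class $[M]$ of $M$ to $X$.
   Context: For a non-empty first-order structure $M$, let $\mathrm{Def}(M)$ be the set of subsets of finite Cartesian powers $M^n$ that are definable with parameters. Two such sets are identified if there is a definable bijection between them; on the quotient $\widetilde{\mathrm{Def}}(M)$, addition is induced by disjoint union and multiplication by Cartesian product, making it a commutative semi-ring. Identifying $a,b$ whenever $a+c=b+c$ for some $c$ gives a cancellative semi-ring, and the Grothendieck ring $K_0(M)$ is the smallest ring containing it (its ring of formal differences). $[A]$ denotes the class of a definable set $A$ in $K_0(M)$. *)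

(* Defs.v *)
From HB Require Import structures.
From mathcomp Require Import all_boot all_order all_algebra.
From mathcomp Require Import boolp classical_sets functions cardinality.

Set Implicit Arguments.
Unset Strict Implicit.
Unset Printing Implicit Defensive.

Import GRing.Theory.
Local Open Scope ring_scope.
Local Open Scope quotient_scope.
Local Open Scope classical_set_scope.

(** Free variables of a formula range over an arbitrary type [V]; a
    quantifier binds the variable [None] of [option V].  A formula in [n]
    variables is thus a [formula L 'I_n], a sentence a [formula L void], and
    a formula in [n] variables with parameters in [M] a
    [formula L ('I_n + M)]. *)

Record language := Language {
  funs : Type;
  fun_arity : funs -> nat;
  rels : Type;
  rel_arity : rels -> nat }.

Record structure (L : language) := Structure {
  carrier :> Type;
  nonempty : inhabited carrier;
  fun_interp : forall s : funs L, ('I_(fun_arity s) -> carrier) -> carrier;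
  rel_interp : forall r : rels L, ('I_(rel_arity r) -> carrier) -> Prop }.

Section Syntax.
Variable L : language.

Inductive term (V : Type) : Type :=
| Var of V
| App (s : funs L) of ('I_(fun_arity s) -> term V).

Inductive formula (V : Type) : Type :=
| FFalse
| FEq of term V & term V
| FRel (r : rels L) of ('I_(rel_arity r) -> term V)
| FAnd of formula V & formula V
| FOr of formula V & formula V
| FImp of formula V & formula V
| FEx of formula (option V)
| FAll of formula (option V).

Definition FNot (V : Type) (p : formula V) := FImp p (FFalse V).
Definition FTrue (V : Type) := FNot (FFalse V).
Definition FIff (V : Type) (p q : formula V) := FAnd (FImp p q) (FImp q p).

Fixpoint trename (V W : Type) (g : V -> W) (t : term V) : term W :=
  match t with
  | Var v => Var (g v)
  | App s a => App (fun i => trename g (a i))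
  end.

Fixpoint frename (V : Type) (p : formula V) :
    forall (W : Type), (V -> W) -> formula W :=
  match p with
  | FFalse => fun W _ => FFalse W
  | FEq t u => fun W g => FEq (trename g t) (trename g u)
  | FRel r a => fun W g => FRel (fun i => trename g (a i))
  | FAnd p q => fun W g => FAnd (frename p g) (frename q g)
  | FOr p q => fun W g => FOr (frename p g) (frename q g)
  | FImp p q => fun W g => FImp (frename p g) (frename q g)
  | FEx p => fun W g => FEx (frename p (option_map g))
  | FAll p => fun W g => FAll (frename p (option_map g))
  end.

Definition I0_elim (T : Type) (i : 'I_0) : T :=
  False_rect T (notF (ltn_ord i)).

Definition elim_I0 (V : Type) (s : V + 'I_0) : V :=
  match s with
  | inl v => v
  | inr i => I0_elim V i
  end.

Definition bind_I0 (V : Type) n (s : V + 'I_n.+1) : option (V + 'I_n) :=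
  match s with
  | inl v => Some (inl v)
  | inr i => omap inr (unlift ord0 i)
  end.

(** Existential quantification over the [n] variables in ['I_n]. *)
Fixpoint FExn (V : Type) n : formula (V + 'I_n) -> formula V :=
  match n with
  | 0 => fun p => frename p (@elim_I0 V)
  | n.+1 => fun p => FExn (FEx (frename p (@bind_I0 V n)))
  end.

End Syntax.

Arguments FFalse {L V}.
Arguments FTrue {L V}.

Section Semantics.
Variables (L : language) (M : structure L).

Definition ocons (V : Type) (m : M) (e : V -> M) (o : option V) : M :=
  if o is Some v then e v else m.

Definition scons (V W : Type) (e : V -> M) (e' : W -> M) (s : V + W) : M :=
  match s with inl v => e v | inr w => e' w end.

Fixpoint teval (V : Type) (e : V -> M) (t : term L V) : M :=
  match t with
  | Var v => e v
  | App s a => fun_interp (fun i => teval e (a i))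
  end.

Fixpoint sat (V : Type) (p : formula L V) : (V -> M) -> Prop :=
  match p with
  | FFalse => fun _ => False
  | FEq t u => fun e => teval e t = teval e u
  | FRel r a => fun e => rel_interp (fun i => teval e (a i))
  | FAnd p q => fun e => sat p e /\ sat q e
  | FOr p q => fun e => sat p e \/ sat q e
  | FImp p q => fun e => sat p e -> sat q e
  | FEx p => fun e => exists m : M, sat p (ocons m e)
  | FAll p => fun e => forall m : M, sat p (ocons m e)
  end.

(** Definability with parameters of a subset of [M^V]; the parameters are the
    free variables in [M], each interpreted by itself. *)
Definition definable (V : Type) (A : set (V -> M)) : Prop :=
  exists p : formula L (V + M), A = [set x | sat p (scons x id)].

Lemma teval_rename (V W : Type) (g : V -> W) e (t : term L V) :
  teval e (trename g t) = teval (e \o g) t.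
Proof.
elim: t => //= s a IH; congr fun_interp.
by apply: funext => i; exact: IH.
Qed.

Lemma sat_rename (V : Type) (p : formula L V) : forall (W : Type) (g : V -> W) e,
  sat (frename p g) e <-> sat p (e \o g).
Proof.
have oconsE (U W : Type) (g : U -> W) e m :
  ocons m e \o option_map g = ocons m (e \o g).
  by apply: funext => -[].
elim: p => {V} /= [V|V t u|V r a|V p IHp q IHq|V p IHp q IHq|V p IHp q IHq
  |V p IH|V p IH] W g e //=.
- by rewrite !teval_rename.
- by under [X in rel_interp X]funext => i do rewrite teval_rename.
- by rewrite IHp IHq.
- by rewrite IHp IHq.
- by rewrite IHp IHq.
- by split=> -[m]; rewrite ?IH ?oconsE => H; exists m; rewrite ?IH ?oconsE.
- by split=> H m; move: (H m); rewrite IH oconsE.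
Qed.

Lemma sat_FExn (V : Type) n (p : formula L (V + 'I_n)) e :
  sat (FExn p) e <-> exists y : 'I_n -> M, sat p (scons e y).
Proof.
elim: n p => [|n IH] p /=.
  rewrite sat_rename; split=> [H|[y H]].
    exists (I0_elim M).
    by congr sat: H; apply: funext => -[//|[]].
  by congr sat: H; apply: funext => -[//|[]].
rewrite IH; split=> [[y /= [m]]|[y H]].
  rewrite sat_rename => H.
  exists (fun i => if unlift ord0 i is Some j then y j else m).
  by congr sat: H; apply: funext => -[//|i] /=; case: unliftP.
exists (y \o lift ord0), (y ord0); rewrite -/(sat _ _) sat_rename.
congr sat: H; apply: funext => -[//|i] /=.
by case: unliftP => [j ->|->].
Qed.

Lemma sat_bigand (V : Type) (I : finType) (P : pred I) (F : I -> formula L V) e :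
  sat (\big[@FAnd L V/FTrue]_(i | P i) F i) e <->
  forall i, P i -> sat (F i) e.
Proof.
have H (r : seq I) : sat (\big[@FAnd L V/FTrue]_(i <- r | P i) F i) e <->
    forall i, i \in r -> P i -> sat (F i) e.
  elim: r => [|j r IH]; first by rewrite big_nil; split=> [_ i|_ []].
  rewrite big_cons; split.
    move=> H i; rewrite inE => /orP[/eqP ->|ir] Pi.
      by move: H; rewrite Pi => -[].
    suff /IH : sat (\big[@FAnd L V/FTrue]_(i <- r | P i) F i) e by exact.
    by case: ifP H => // _ [].
  move=> H; have Hr : sat (\big[@FAnd L V/FTrue]_(i <- r | P i) F i) e.
    by apply/IH => i ir; apply: H; rewrite inE ir orbT.
  by case: ifP => // Pj; split=> //; apply: H => //; rewrite inE eqxx.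
rewrite H; split=> K i; last by move=> _; exact: K.
by apply: K; rewrite mem_index_enum.
Qed.

Lemma sat_bigor (V : Type) (I : finType) (P : pred I) (F : I -> formula L V) e :
  sat (\big[@FOr L V/FFalse]_(i | P i) F i) e <->
  exists2 i, P i & sat (F i) e.
Proof.
have H (r : seq I) : sat (\big[@FOr L V/FFalse]_(i <- r | P i) F i) e <->
    exists2 i, i \in r & P i /\ sat (F i) e.
  elim: r => [|j r IH]; first by rewrite big_nil; split=> // -[].
  rewrite big_cons; split.
    case: ifP => [Pj [Fj|/IH[i ir Fi]]|_ /IH[i ir Fi]].
    - by exists j; rewrite ?inE ?eqxx.
    - by exists i; rewrite ?inE ?ir ?orbT.
    - by exists i; rewrite ?inE ?ir ?orbT.
  case=> i; rewrite inE => /orP[/eqP ->|ir] [Pi Fi].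
    by rewrite Pi; left.
  have Hr : sat (\big[@FOr L V/FFalse]_(i <- r | P i) F i) e.
    by apply/IH; exists i.
  by case: ifP => // _; right.
rewrite H; split=> -[i]; first by move=> _ []; exists i.
by exists i; rewrite ?mem_index_enum.
Qed.

End Semantics.

Section Definable.
Variables (L : language) (M : structure L).

(** [M^V * M^W] is identified with [M^(V + W)], where the graph lives. *)
Definition definable_bij (V W : Type) (A : set (V -> M)) (B : set (W -> M)) :
    Prop :=
  exists f : (V -> M) -> (W -> M), set_bij A B f /\
    definable [set z : V + W -> M | A (z \o inl) /\ z \o inr = f (z \o inl)].

Record defset := DefSet {
  arity : nat;
  dset :> set ('I_arity -> M);
  dsetP : definable dset }.

Lemma definable_sub (V W : Type) (A : set (W -> M)) (g : W -> V + M) :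
  definable A -> definable [set x : V -> M | A (fun w => scons x id (g w))].
Proof.
move=> [p ->].
exists (frename p (fun s : W + M => match s with inl w => g w | inr m => inr m end)).
apply/seteqP; split=> x /=; rewrite sat_rename => H;
  by congr sat: H; apply: funext => -[].
Qed.

Lemma definable_subl (V W : Type) (A : set (W -> M)) (g : W -> V) :
  definable A -> definable [set x : V -> M | A (x \o g)].
Proof. exact: (@definable_sub V W A (inl \o g)). Qed.

Lemma definableI (V : Type) (A B : set (V -> M)) :
  definable A -> definable B -> definable (A `&` B).
Proof. by move=> [p ->] [q ->]; exists (FAnd p q). Qed.

Lemma definableU (V : Type) (A B : set (V -> M)) :
  definable A -> definable B -> definable (A `|` B).
Proof. by move=> [p ->] [q ->]; exists (FOr p q). Qed.

Lemma definableC (V : Type) (A : set (V -> M)) :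
  definable A -> definable (~` A).
Proof. by move=> [p ->]; exists (FNot p). Qed.

Lemma definable0 (V : Type) : definable (@set0 (V -> M)).
Proof. by exists FFalse. Qed.

Lemma definableT (V : Type) : definable [set: V -> M].
Proof. by rewrite -setC0; apply: definableC; exact: definable0. Qed.

Lemma definable_eq (V : Type) (s t : V + M) :
  definable [set x : V -> M | scons x id s = scons x id t].
Proof. by exists (FEq (Var L s) (Var L t)). Qed.

Lemma definable_ex (V : Type) n (A : set (V + 'I_n -> M)) :
  definable A -> definable [set x : V -> M | exists y, A (scons x y)].
Proof.
move=> [p ->]; pose s (u : (V + 'I_n) + M) : (V + M) + 'I_n :=
  match u with
  | inl (inl v) => inl (inl v) | inl (inr i) => inr i | inr m => inl (inr m)
  end.
exists (FExn (frename p s)); apply/seteqP; split=> x /=.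
  move=> [y H]; apply/sat_FExn; exists y; apply/sat_rename.
  by congr sat: H; apply: funext => -[[]|].
move=> /sat_FExn[y /sat_rename H]; exists y.
by congr sat: H; apply: funext => -[[]|].
Qed.

Lemma definable_all (V : Type) (I : finType) (F : I -> set (V -> M)) :
  (forall i, definable (F i)) -> definable [set x | forall i, F i x].
Proof.
move=> /choice[p pP]; exists (\big[@FAnd L _/FTrue]_i p i).
apply/seteqP; split=> x /=.
  by move=> H; apply/sat_bigand => i _; have := H i; rewrite pP.
by move=> /sat_bigand H i; rewrite pP; exact: H.
Qed.

Lemma scons_comp (V W : Type) (z : V + W -> M) :
  scons (z \o inl) (z \o inr) = z.
Proof. by apply: funext => -[]. Qed.

Definition rbij (V W : Type) (A : set (V -> M)) (B : set (W -> M))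
    (r : (V -> M) -> (W -> M) -> Prop) : Prop :=
  [/\ definable [set z : V + W -> M | r (z \o inl) (z \o inr)],
      forall x y, r x y -> A x /\ B y,
      forall x, A x -> exists y, r x y,
      forall y, B y -> exists x, r x y &
      forall x y x' y', r x y -> r x' y' -> (x = x' <-> y = y')].

Lemma definable_bijP (V W : Type) (A : set (V -> M)) (B : set (W -> M)) :
  definable_bij A B <-> exists r, rbij A B r.
Proof.
split=> [[f [[fAB finj fsurj] df]]|[r [dr rAB rA rB rinj]]].
  exists (fun x y => A x /\ y = f x); split=> //.
  - by move=> x _ [Ax ->]; split=> //; exact: fAB.
  - by move=> x Ax; exists (f x).
  - by move=> y /fsurj[x Ax <-]; exists x.
  - move=> x _ x' _ [Ax ->] [Ax' ->]; split=> [->//|].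
    by apply: finj; rewrite inE.
have y0 : W -> M by move=> _; case: (cid (let: inhabits m := nonempty M in
  ex_intro (fun _ => True) m I)) => m _; exact: m.
have /choice[f fP] : forall x, exists y, A x -> r x y.
  move=> x; case: (pselect (A x)) => [/rA[y]|nA]; first by exists y.
  by exists y0.
exists f; split; last first.
  congr definable: dr; apply/seteqP; split=> z /=.
    by move=> rz; have [Az _] := rAB _ _ rz; split=> //;
      apply/(rinj _ _ _ _ rz (fP _ Az)).
  by move=> [/fP + ->].
split.
- by move=> x /fP /rAB[].
- move=> x x'; rewrite !inE => /fP + /fP +.
  by move=> h h' e; apply/(rinj _ _ _ _ h h').
- move=> y /rB[x rxy]; have [Ax _] := rAB _ _ rxy; exists x => //.
  by apply/(rinj _ _ _ _ (fP _ Ax) rxy).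
Qed.

Lemma definable_bij_sym (V W : Type) (A : set (V -> M)) (B : set (W -> M)) :
  definable_bij A B -> definable_bij B A.
Proof.
move=> /definable_bijP[r [dr rAB rA rB rinj]]; apply/definable_bijP.
exists (fun y x => r x y); split=> //.
- exact: (definable_subl
    (fun s : V + W => match s with inl v => inr v | inr w => inl w end) dr).
- by move=> y x /rAB[].
- by move=> y x y' x' h h'; rewrite (rinj _ _ _ _ h h').
Qed.

Lemma definable_bij_trans (V X : Type) n (A : set (V -> M))
    (B : set ('I_n -> M)) (C : set (X -> M)) :
  definable_bij A B -> definable_bij B C -> definable_bij A C.
Proof.
move=> /definable_bijP[r [dr rAB rA rB rinj]].
move=> /definable_bijP[q [dq qBC qB qC qinj]].
apply/definable_bijP; exists (fun x z => exists y, r x y /\ q y z); split.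
- have d1 := definable_subl (fun s : V + 'I_n => match s return (V + X) + 'I_n
    with inl v => inl (inl v) | inr i => inr i end) dr.
  have d2 := definable_subl (fun s : 'I_n + X => match s return (V + X) + 'I_n
    with inl i => inr i | inr x => inl (inr x) end) dq.
  exact: (definable_ex (definableI d1 d2)).
- by move=> x z [y [/rAB[Ax _] /qBC[]]].
- move=> x /rA[y rxy]; have [_ /qB[z qyz]] := rAB _ _ rxy.
  by exists z, y.
- move=> z /qC[y qyz]; have [/rB[x rxy] _] := qBC _ _ qyz.
  by exists x, y.
- move=> x z x' z' [y [h k]] [y' [h' k']].
  by rewrite (rinj _ _ _ _ h h') (qinj _ _ _ _ k k').
Qed.

Lemma definable_bij_coord (V : Type) n (A : set (V -> M))
    (B : set ('I_n -> M)) (h : 'I_n -> V + M) :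
  definable A -> set_bij A B (fun x i => scons x id (h i)) ->
  definable_bij A B.
Proof.
move=> dA bAB; exists (fun x i => scons x id (h i)); split=> //.
apply: (@definableI _ [set z : V + 'I_n -> M | A (z \o inl)]
  [set z : V + 'I_n -> M | z \o inr = _]); first exact: definable_subl.
have -> : [set z : V + 'I_n -> M |
    z \o inr = fun i => scons (z \o inl) id (h i)] =
  [set z | forall i, scons z id (inl (inr i)) = scons z id
    match h i with inl v => inl (inl v) | inr m => inr m end].
  apply/seteqP; split=> z /=.
    by move=> H i; rewrite -[LHS]/((z \o inr) i) H; case: (h i).
  by move=> H; apply: funext => i /=; rewrite H; case: (h i).
by apply: definable_all => i; exact: definable_eq.
Qed.

Lemma definable_bij_refl n (A : set ('I_n -> M)) :
  definable A -> definable_bij A A.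
Proof.
move=> dA; apply: (@definable_bij_coord _ _ _ _ inl) => //.
by split=> // x Ax; exists x.
Qed.

Lemma definable_bijU (V W : Type) (A A' : set (V -> M)) (B B' : set (W -> M)) :
  A `&` A' = set0 -> B `&` B' = set0 ->
  definable_bij A B -> definable_bij A' B' ->
  definable_bij (A `|` A') (B `|` B').
Proof.
move=> AA BB /definable_bijP[r [dr rAB rA rB rinj]].
move=> /definable_bijP[q [dq qAB qA qB qinj]].
have {}AA x : A x -> A' x -> False by move=> a a'; rewrite -[False]/(set0 x) -AA.
have {}BB y : B y -> B' y -> False by move=> a a'; rewrite -[False]/(set0 y) -BB.
apply/definable_bijP; exists (fun x y => r x y \/ q x y); split.
- exact: definableU.
- by move=> x y [/rAB|/qAB] []; split; [left|left|right|right].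
- by move=> x [/rA|/qA] [y]; exists y; [left|right].
- by move=> y [/rB|/qB] [x]; exists x; [left|right].
move=> x y x' y' [h|h] [h'|h'].
- exact: rinj h h'.
- have [a b] := rAB _ _ h; have [a' b'] := qAB _ _ h'.
  by split=> e; subst; [case: (AA _ a a')|case: (BB _ b b')].
- have [a b] := qAB _ _ h; have [a' b'] := rAB _ _ h'.
  by split=> e; subst; [case: (AA _ a' a)|case: (BB _ b' b)].
- exact: qinj h h'.
Qed.

Lemma definable_bij_split (V : Type) n (A : set (V -> M))
    (B B' : set ('I_n -> M)) :
  B `&` B' = set0 -> definable B -> definable B' ->
  definable_bij A (B `|` B') ->
  exists A1 A2, [/\ A = A1 `|` A2, A1 `&` A2 = set0,
    definable_bij A1 B & definable_bij A2 B'].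
Proof.
move=> BB dB dB' /definable_bijP[r [dr rAB rA rB rinj]].
have {}BB y : B y -> B' y -> False by move=> a a'; rewrite -[False]/(set0 y) -BB.
have bij D : definable D -> D `<=` B `|` B' ->
    definable_bij [set x | exists2 y, D y & r x y] D.
  move=> dD DB; apply/definable_bijP; exists (fun x y => D y /\ r x y); split.
  - apply: (definableI (A := [set z : V + 'I_n -> M | D (z \o inr)])) => //.
    exact: definable_subl.
  - by move=> x y [Dy rxy]; split=> //; exists y.
  - by move=> x [y]; exists y.
  - by move=> y Dy; have [x rxy] := rB _ (DB _ Dy); exists x.
  - by move=> x y x' y' [_ h] [_ h']; exact: rinj h h'.
exists [set x | exists2 y, B y & r x y], [set x | exists2 y, B' y & r x y].
split; last 2 first.
- by apply: bij => // y; left.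
- by apply: bij => // y; right.
- apply/seteqP; split=> x /=.
    move=> /rA[y rxy]; have [_ [Dy|Dy]] := rAB _ _ rxy.
      by left; exists y.
    by right; exists y.
  by move=> [] [y _ /rAB[]].
- apply/seteqP; split=> // x /= [[y By rxy] [y' By' rxy']].
  have /(rinj _ _ _ _ rxy rxy') e : x = x by [].
  by subst y'; case: (BB y).
Qed.

Definition joinI m n (x : 'I_m -> M) (y : 'I_n -> M) : 'I_(m + n) -> M :=
  fun i => scons x y (fintype.split i).

Lemma joinIl m n (x : 'I_m -> M) (y : 'I_n -> M) : joinI x y \o lshift n = x.
Proof.
by apply: funext => i; rewrite /joinI /= (unsplitK (inl i : 'I_m + 'I_n)).
Qed.

Lemma joinIr m n (x : 'I_m -> M) (y : 'I_n -> M) : joinI x y \o @rshift m n = y.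
Proof.
by apply: funext => i; rewrite /joinI /= (unsplitK (inr i : 'I_m + 'I_n)).
Qed.

Lemma joinI_eta m n (z : 'I_(m + n) -> M) :
  joinI (z \o lshift n) (z \o @rshift m n) = z.
Proof. by apply: funext => i; rewrite /joinI; case: split_ordP => j ->. Qed.

Lemma joinIP m n (z z' : 'I_(m + n) -> M) :
  z = z' <-> z \o lshift n = z' \o lshift n /\
    z \o @rshift m n = z' \o @rshift m n.
Proof.
by split=> [->//|[e e']]; rewrite -(joinI_eta z) e e' joinI_eta.
Qed.

Definition prod_set m n (A : set ('I_m -> M)) (B : set ('I_n -> M)) :
    set ('I_(m + n) -> M) :=
  [set z : 'I_(m + n) -> M | A (z \o lshift n) /\ B (z \o @rshift m n)].

Lemma definable_prod m n (A : set ('I_m -> M)) (B : set ('I_n -> M)) :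
  definable A -> definable B -> definable (prod_set A B).
Proof. by move=> dA dB; apply: definableI; exact: definable_subl. Qed.

Lemma definable_bijX m n m' n' (A : set ('I_m -> M)) (B : set ('I_n -> M))
    (A' : set ('I_m' -> M)) (B' : set ('I_n' -> M)) :
  definable_bij A A' -> definable_bij B B' ->
  definable_bij (prod_set A B) (prod_set A' B').
Proof.
move=> /definable_bijP[r [dr rAB rA rB rinj]].
move=> /definable_bijP[q [dq qAB qA qB qinj]].
apply/definable_bijP; exists (fun x y => r (x \o lshift n) (y \o lshift n') /\
  q (x \o @rshift m n) (y \o @rshift m' n')); split.
- have d1 := definable_subl (fun s : 'I_m + 'I_m' => match s return
    'I_(m + n) + 'I_(m' + n') with
    | inl i => inl (lshift n i) | inr i => inr (lshift n' i) end) dr.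
  have d2 := definable_subl (fun s : 'I_n + 'I_n' => match s return
    'I_(m + n) + 'I_(m' + n') with
    | inl i => inl (rshift m i) | inr i => inr (rshift m' i) end) dq.
  exact: (definableI d1 d2).
- by move=> x y [/rAB[? ?] /qAB[? ?]].
- move=> x [/rA[y h] /qA[y' h']]; exists (joinI y y').
  by rewrite joinIl joinIr.
- move=> x [/rB[y h] /qB[y' h']]; exists (joinI y y').
  by rewrite joinIl joinIr.
move=> x y x' y' [h k] [h' k']; rewrite !joinIP.
by rewrite (rinj _ _ _ _ h h') (qinj _ _ _ _ k k').
Qed.

(** For [a <> b], [left_copy a A] and [right_copy b B] are disjoint copies of
    [A] and [B] in the same power of [M]. *)
Definition left_copy (a : M) m n (A : set ('I_m -> M)) :
    set ('I_(m + n).+1 -> M) :=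
  [set z | [/\ z ord0 = a, A (fun i => z (lift ord0 (lshift n i))) &
               forall j : 'I_n, z (lift ord0 (rshift m j)) = a]].

Definition right_copy (b : M) m n (B : set ('I_n -> M)) :
    set ('I_(m + n).+1 -> M) :=
  [set z | [/\ z ord0 = b, B (fun j => z (lift ord0 (rshift m j))) &
               forall i : 'I_m, z (lift ord0 (lshift n i)) = b]].

Lemma definable_left_copy a m n (A : set ('I_m -> M)) :
  definable A -> definable (@left_copy a m n A).
Proof.
move=> dA; have d1 := @definable_eq 'I_(m + n).+1 (inl ord0) (inr a).
have d2 := definable_subl (fun i => lift ord0 (lshift n i)) dA.
have d3 : definable [set x : 'I_(m + n).+1 -> M |
    forall j : 'I_n, x (lift ord0 (rshift m j)) = a].
  by apply: definable_all => j; exact: (@definable_eq _ (inl _) (inr a)).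
congr definable: (definableI (definableI d1 d2) d3).
by apply/seteqP; split=> x /= => [[[]]|[]].
Qed.

Lemma definable_right_copy b m n (B : set ('I_n -> M)) :
  definable B -> definable (@right_copy b m n B).
Proof.
move=> dA; have d1 := @definable_eq 'I_(m + n).+1 (inl ord0) (inr b).
have d2 := definable_subl (fun i => lift ord0 (rshift m i)) dA.
have d3 : definable [set x : 'I_(m + n).+1 -> M |
    forall j : 'I_m, x (lift ord0 (lshift n j)) = b].
  by apply: definable_all => j; exact: (@definable_eq _ (inl _) (inr b)).
congr definable: (definableI (definableI d1 d2) d3).
by apply/seteqP; split=> x /= => [[[]]|[]].
Qed.

Lemma left_copy_bij a m n (A : set ('I_m -> M)) :
  definable A -> definable_bij (@left_copy a m n A) A.
Proof.
move=> dA; apply: (@definable_bij_coord _ _ _ _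
  (fun i => inl (lift ord0 (lshift n i)))); first exact: definable_left_copy.
split=> [z [] //|z z'|x Ax].
  rewrite !inE => -[z0 _ zr] [z0' _ zr'] /(congr1 (fun f => f _)) e.
  apply: funext => i; case: (unliftP ord0 i) => [j ->|->]; last by rewrite z0.
  by case: (split_ordP j) => k ->; [exact: e|rewrite zr zr'].
exists (fun i => if unlift ord0 i is Some j
  then joinI x (fun _ => a) j else a).
  split=> [|//=|j]; rewrite ?unlift_none //.
  - congr A: Ax; apply: funext => i; rewrite liftK.
    by rewrite -[RHS]/((joinI x (fun=> a) \o lshift n) i) joinIl.
  - by rewrite liftK -[LHS]/((joinI x (fun=> a) \o @rshift m n) j) joinIr.
apply: funext => i /=; rewrite liftK.
by rewrite -[LHS]/((joinI x (fun=> a) \o lshift n) i) joinIl.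
Qed.

Lemma right_copy_bij b m n (B : set ('I_n -> M)) :
  definable B -> definable_bij (@right_copy b m n B) B.
Proof.
move=> dA; apply: (@definable_bij_coord _ _ _ _
  (fun i => inl (lift ord0 (rshift m i)))); first exact: definable_right_copy.
split=> [z [] //|z z'|x Ax].
  rewrite !inE => -[z0 _ zr] [z0' _ zr'] /(congr1 (fun f => f _)) e.
  apply: funext => i; case: (unliftP ord0 i) => [j ->|->]; last by rewrite z0.
  by case: (split_ordP j) => k ->; [rewrite zr zr'|exact: e].
exists (fun i => if unlift ord0 i is Some j
  then joinI (fun _ => b) x j else b).
  split=> [|//=|j]; rewrite ?unlift_none //.
  - congr B: Ax; apply: funext => i; rewrite liftK.
    by rewrite -[RHS]/((joinI (fun=> b) x \o @rshift m n) i) joinIr.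
  - by rewrite liftK -[LHS]/((joinI (fun=> b) x \o lshift n) j) joinIl.
apply: funext => i /=; rewrite liftK.
by rewrite -[LHS]/((joinI (fun=> b) x \o @rshift m n) i) joinIr.
Qed.

Lemma copy_disj a b m n (A : set ('I_m -> M)) (B : set ('I_n -> M)) :
  a <> b -> left_copy a A `&` right_copy b B = set0.
Proof.
move=> ab; apply/seteqP; split=> // z [[z0 _ _] [z0' _ _]].
by apply: ab; rewrite -z0 -z0'.
Qed.

End Definable.

Arguments dset {L M} d _.

Section DefSemiring.
Variables (L : language) (M : structure L).

HB.instance Definition _ := gen_eqMixin (defset M).
HB.instance Definition _ := gen_choiceMixin (defset M).

Definition dpower n : defset M := DefSet (definableT M 'I_n).
Definition dempty : defset M := DefSet (definable0 M 'I_0).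
Definition dprod (A B : defset M) : defset M :=
  DefSet (definable_prod (dsetP A) (dsetP B)).

Definition nontrivial : Prop := exists x y : M, x <> y.

Definition defiso (A B : defset M) : bool := `[< definable_bij A B >].

Lemma defiso_refl : reflexive defiso.
Proof. by move=> A; apply/asboolP/definable_bij_refl/dsetP. Qed.

Lemma defiso_sym : symmetric defiso.
Proof.
by move=> A B; apply/idP/idP => /asboolP H; apply/asboolP/definable_bij_sym.
Qed.

Lemma defiso_trans : transitive defiso.
Proof.
move=> B A C /asboolP H /asboolP K.
by apply/asboolP; exact: definable_bij_trans H K.
Qed.

Canonical defiso_equiv := EquivRel defiso defiso_refl defiso_sym defiso_trans.

(** If [M] has only one element, then no [M^n] contains two disjoint non-empty
    sets, so that [Def(M)] is not closed under disjoint unions; the semi-ring is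
    hence defined for an [M] with two elements.  The class of the sum does not
    depend on the choice of the disjoint copies: see [dclassU]. *)
Definition Deftilde (hM : nontrivial) : Type := {eq_quot defiso}.
HB.instance Definition _ hM := EqQuotient.on (Deftilde hM).
HB.instance Definition _ hM := Choice.on (Deftilde hM).

Section TwoElements.
Hypothesis hM : nontrivial.

Local Notation D := (Deftilde hM).

Definition dclass (A : defset M) : D := \pi_D A.

Let a : M := sval (cid hM).
Let b : M := sval (cid (svalP (cid hM))).

Let ab : a <> b.
Proof. exact: (svalP (cid (svalP (cid hM)))). Qed.

Definition dsum (A B : defset M) : defset M :=
  DefSet (definableU (@definable_left_copy _ _ a _ (arity B) _ (dsetP A))
                     (@definable_right_copy _ _ b (arity A) _ _ (dsetP B))).

Definition Deftilde_add (x y : D) : D :=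
  dclass (dsum (repr x) (repr y)).
Definition Deftilde_mul (x y : D) : D :=
  dclass (dprod (repr x) (repr y)).

Lemma dclassP A B : dclass A = dclass B <-> definable_bij A B.
Proof. by split=> [/eqmodP/asboolP|H] //; apply/eqmodP/asboolP. Qed.

Lemma repr_bij A : definable_bij (repr (dclass A)) A.
Proof. by apply/dclassP; exact: reprK. Qed.

Lemma dsum_bij V (C D : set (V -> M)) (A B : defset M) :
  C `&` D = set0 -> definable_bij C A -> definable_bij D B ->
  definable_bij (C `|` D) (dsum A B).
Proof.
move=> CD CA DB; apply: definable_bijU => //; first exact: copy_disj.
  apply: definable_bij_trans CA _.
  exact/definable_bij_sym/left_copy_bij/dsetP.
apply: definable_bij_trans DB _.
exact/definable_bij_sym/right_copy_bij/dsetP.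
Qed.

Lemma dclassD A B : Deftilde_add (dclass A) (dclass B) = dclass (dsum A B).
Proof.
apply/dclassP/dsum_bij; first exact: copy_disj.
  exact: definable_bij_trans (left_copy_bij _ _ (dsetP _)) (repr_bij A).
exact: definable_bij_trans (right_copy_bij _ _ (dsetP _)) (repr_bij B).
Qed.

Lemma dclassM A B : Deftilde_mul (dclass A) (dclass B) = dclass (dprod A B).
Proof. by apply/dclassP/definable_bijX; exact: repr_bij. Qed.

Lemma dclassU n (A B : set ('I_n -> M)) (dA : definable A) (dB : definable B) :
  A `&` B = set0 -> dclass (DefSet (definableU dA dB)) =
    Deftilde_add (dclass (DefSet dA)) (dclass (DefSet dB)).
Proof.
move=> AB; rewrite dclassD; apply/dclassP/dsum_bij => //;
  exact: definable_bij_refl.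
Qed.

Lemma Deftilde_ind (P : D -> Prop) :
  (forall A, P (dclass A)) -> forall x, P x.
Proof. by move=> H x; rewrite -[x]reprK; exact: H. Qed.

Lemma Deftilde_addC : commutative Deftilde_add.
Proof.
elim/Deftilde_ind => A; elim/Deftilde_ind => B; rewrite !dclassD.
apply/dclassP; rewrite [dset (dsum A B)]setUC; apply: dsum_bij.
- by rewrite setIC; exact: copy_disj.
- exact: right_copy_bij (dsetP _).
- exact: left_copy_bij (dsetP _).
Qed.

Lemma dsum_split V (X : set (V -> M)) (A B : defset M) :
  definable_bij X (dsum A B) -> exists X1 X2, [/\ X = X1 `|` X2,
    X1 `&` X2 = set0, definable_bij X1 A & definable_bij X2 B].
Proof.
case/definable_bij_split => [|||X1 [X2 [-> X12 b1 b2]]].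
- exact: copy_disj.
- exact/definable_left_copy/dsetP.
- exact/definable_right_copy/dsetP.
exists X1, X2; split=> //.
  exact: definable_bij_trans b1 (left_copy_bij _ _ (dsetP _)).
exact: definable_bij_trans b2 (right_copy_bij _ _ (dsetP _)).
Qed.

Lemma Deftilde_addA : associative Deftilde_add.
Proof.
elim/Deftilde_ind => A; elim/Deftilde_ind => B; elim/Deftilde_ind => C.
rewrite !dclassD; apply/dclassP/definable_bij_sym.
have /dsum_split[X [Z [-> XZ /dsum_split[X1 [X2 [eX X12 b1 b2]]] bC]]] :=
  definable_bij_refl (dsetP (dsum (dsum A B) C)).
rewrite eX -setUA; apply: dsum_bij => //.
  rewrite setIUr X12 set0U -subset0 -XZ eX => z [h h'].
  by split=> //; left.
apply: dsum_bij => //.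
by rewrite -subset0 -XZ eX => z [h h']; split=> //; right.
Qed.

Lemma definable_bij0 V n : definable_bij (@set0 (V -> M)) (@set0 ('I_n -> M)).
Proof.
apply: (@definable_bij_coord _ _ _ _ _ _ (fun=> inr a)).
  exact: definable0.
by split=> // x; rewrite inE.
Qed.

Lemma Deftilde_add0 : left_id (dclass dempty) Deftilde_add.
Proof.
elim/Deftilde_ind => A; rewrite dclassD; apply/dclassP/definable_bij_sym.
rewrite -[dset A]set0U; apply: dsum_bij; rewrite ?set0I //.
  exact: definable_bij0.
exact/definable_bij_refl/dsetP.
Qed.

Lemma Deftilde_mulC : commutative Deftilde_mul.
Proof.
elim/Deftilde_ind => A; elim/Deftilde_ind => B; rewrite !dclassM.
apply/dclassP.
apply: (@definable_bij_coord _ _ _ _ _ _ (fun i => inl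
  match fintype.split i with inl j => rshift _ j | inr j => lshift _ j end)).
  exact: (dsetP (dprod A B)).
have E (x : 'I_(arity A + arity B) -> M) : (fun i : 'I_(arity B + arity A) =>
   scons x id (inl match fintype.split i with
     inl j => rshift _ j | inr j => lshift _ j end)) =
   joinI (x \o @rshift _ _) (x \o lshift _).
  by apply: funext => i /=; rewrite /joinI; case: fintype.split.
split=> [x [Ax Bx]|x y _ _|z [Bz Az]]; rewrite ?E.
- by rewrite /= /prod_set /= joinIl joinIr.
- by move=> /joinIP; rewrite !joinIl !joinIr => -[e e']; apply/joinIP.
exists (joinI (z \o @rshift _ _) (z \o lshift _)).
  by rewrite /= /prod_set /= joinIl joinIr.
by rewrite E joinIl joinIr joinI_eta.
Qed.

Lemma Deftilde_mulA : associative Deftilde_mul.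
Proof.
elim/Deftilde_ind => A; elim/Deftilde_ind => B; elim/Deftilde_ind => C.
rewrite !dclassM; apply/dclassP.
pose addE := addnA (arity A) (arity B) (arity C).
apply: (@definable_bij_coord _ _ _ _ _ _
  (fun i => inl (cast_ord (esym addE) i)));
  first exact: (dsetP (dprod A (dprod B C))).
have e1 x : (fun i => x (cast_ord (esym addE) i)) \o lshift (arity C) =
    joinI (x \o lshift _) (x \o @rshift _ _ \o lshift _) :> ('I_(_ + _) -> M).
  apply/joinIP; rewrite joinIl joinIr; split; apply: funext => i /=;
    by congr x; apply: val_inj.
have e2 x : (fun i => x (cast_ord (esym addE) i)) \o @rshift _ (arity C) =
    x \o @rshift _ _ \o @rshift _ _ :> ('I_ _ -> M).
  by apply: funext => i /=; congr x; apply: val_inj; rewrite /= addnA.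
have eK (x y : 'I_(arity A + (arity B + arity C)) -> M) :
    (fun i => x (cast_ord (esym addE) i)) =
    (fun i => y (cast_ord (esym addE) i)) -> x = y.
  move=> e; apply: funext => i; rewrite -[i](cast_ordK addE).
  exact: (congr1 (fun f => f (cast_ord addE i)) e).
split=> [x [Ax [Bx Cx]]|x y _ _ /=|z [[Az Bz] Cz]].
- by rewrite /= /prod_set /= e1 e2 joinIl joinIr.
- exact: eK.
exists (fun i => z (cast_ord addE i)); last first.
  by apply: funext => i /=; rewrite cast_ordKV.
set x := (fun i => _); have ex : z = fun i => x (cast_ord (esym addE) i).
  by apply: funext => i; rewrite /x /= cast_ordKV.
move: Az Bz Cz; rewrite ex /= /prod_set /= e1 e2 joinIl joinIr.
by [].
Qed.

Lemma Deftilde_mul1 : left_id (dclass (dpower 0)) Deftilde_mul.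
Proof.
elim/Deftilde_ind => A; rewrite dclassM; apply/dclassP.
have E (x : 'I_(0 + arity A) -> M) i : x (rshift 0 i) = x i.
  by congr x; apply: val_inj.
apply: (@definable_bij_coord _ _ _ _ _ _ (fun i => inl (rshift 0 i))).
  exact: (dsetP (dprod (dpower 0) A)).
split=> [x [_ Ax] //|x y _ _ e|z Az].
  by apply: funext => i; have := congr1 (fun f => f i) e; rewrite /= !E.
by exists z; [split=> //|]; last (apply: funext => i; exact: E);
  congr (dset _): Az; apply: funext => i /=; rewrite E.
Qed.

Lemma Deftilde_mulDl : left_distributive Deftilde_mul Deftilde_add.
Proof.
elim/Deftilde_ind => A; elim/Deftilde_ind => B; elim/Deftilde_ind => C.
rewrite !(dclassD, dclassM); apply/dclassP.
have -> : dset (dprod (dsum A B) C) =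
    prod_set (@left_copy _ M a _ (arity B) A) C `|`
    prod_set (@right_copy _ M b (arity A) _ B) C.
  apply/seteqP; split=> z; first by move=> [[h|h] k]; [left|right].
  by move=> [[h k]|[h k]]; split=> //; [left|right].
apply: dsum_bij.
- rewrite -subset0 => z [[h _] [h' _]].
  have := copy_disj (dset A) (dset B) ab; rewrite -subset0 => K.
  exact: (K _ (conj h h')).
- apply: definable_bijX; first exact: left_copy_bij (dsetP _).
  exact: definable_bij_refl (dsetP _).
- apply: definable_bijX; first exact: right_copy_bij (dsetP _).
  exact: definable_bij_refl (dsetP _).
Qed.

Lemma Deftilde_mul0 : left_zero (dclass dempty) Deftilde_mul.
Proof.
elim/Deftilde_ind => A; rewrite dclassM; apply/dclassP.
have -> : dset (dprod dempty A) = set0 by rewrite -subset0 => z [].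
exact: definable_bij0.
Qed.

HB.instance Definition _ := GRing.isNmodule.Build D
  Deftilde_addA Deftilde_addC Deftilde_add0.
HB.instance Definition _ := GRing.Nmodule_isComPzSemiRing.Build D
  Deftilde_mulA Deftilde_mulC Deftilde_mul1 Deftilde_mulDl Deftilde_mul0.

End TwoElements.
End DefSemiring.

Section Cancellative.
Variable S : comPzSemiRingType.

Definition cancel_rel (x y : S) : bool := `[< exists z, x + z = y + z >].

Lemma cancel_rel_refl : reflexive cancel_rel.
Proof. by move=> x; apply/asboolP; exists 0. Qed.

Lemma cancel_rel_sym : symmetric cancel_rel.
Proof.
by move=> x y; apply/idP/idP => /asboolP[z e]; apply/asboolP; exists z.
Qed.

Lemma cancel_rel_trans : transitive cancel_rel.
Proof.
move=> y x z /asboolP[u xy] /asboolP[v yz]; apply/asboolP; exists (u + v).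
by rewrite addrA xy -addrA [u + v]addrC addrA yz -addrA [v + u]addrC.
Qed.

Canonical cancel_equiv :=
  EquivRel cancel_rel cancel_rel_refl cancel_rel_sym cancel_rel_trans.

Definition cancellative : Type := {eq_quot cancel_rel}.
HB.instance Definition _ := EqQuotient.on cancellative.
HB.instance Definition _ := Choice.on cancellative.

Definition to_cancellative (x : S) : cancellative := \pi_cancellative x.
Local Notation "[ x ]" := (to_cancellative x).

Lemma to_cancellativeP x y : [x] = [y] <-> exists z, x + z = y + z.
Proof. by split=> [/eqmodP/asboolP|H] //; apply/eqmodP/asboolP. Qed.

Definition cancellative_add (x y : cancellative) : cancellative :=
  [repr x + repr y].
Definition cancellative_mul (x y : cancellative) : cancellative :=
  [repr x * repr y].

Lemma cancellative_repr x : exists z, repr [x] + z = x + z.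
Proof. by apply/to_cancellativeP; exact: reprK. Qed.

Lemma to_cancellativeD x y : cancellative_add [x] [y] = [x + y].
Proof.
have [u xu] := cancellative_repr x; have [v yv] := cancellative_repr y.
by apply/to_cancellativeP; exists (u + v); rewrite addrACA xu yv addrACA.
Qed.

Lemma to_cancellativeM x y : cancellative_mul [x] [y] = [x * y].
Proof.
have [u xu] := cancellative_repr x; have [v yv] := cancellative_repr y.
apply/to_cancellativeP.
move: (repr [x]) (repr [y]) xu yv => x' y' xu yv.
exists (u * y' + x * v).
by rewrite addrA -mulrDl xu mulrDl addrAC -mulrDr yv mulrDr -addrA
  [x * v + _]addrC.
Qed.

Lemma cancellative_ind (P : cancellative -> Prop) :
  (forall x, P [x]) -> forall x, P x.
Proof. by move=> H x; rewrite -[x]reprK; exact: H. Qed.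

Lemma cancellative_addA : associative cancellative_add.
Proof.
by do 3!elim/cancellative_ind => ?; rewrite !to_cancellativeD addrA.
Qed.

Lemma cancellative_addC : commutative cancellative_add.
Proof.
by do 2!elim/cancellative_ind => ?; rewrite !to_cancellativeD addrC.
Qed.

Lemma cancellative_add0 : left_id [0] cancellative_add.
Proof. by elim/cancellative_ind => ?; rewrite to_cancellativeD add0r. Qed.

Lemma cancellative_mulA : associative cancellative_mul.
Proof.
by do 3!elim/cancellative_ind => ?; rewrite !to_cancellativeM mulrA.
Qed.

Lemma cancellative_mulC : commutative cancellative_mul.
Proof.
by do 2!elim/cancellative_ind => ?; rewrite !to_cancellativeM mulrC.
Qed.

Lemma cancellative_mul1 : left_id [1] cancellative_mul.
Proof. by elim/cancellative_ind => ?; rewrite to_cancellativeM mul1r. Qed.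

Lemma cancellative_mulDl : left_distributive cancellative_mul cancellative_add.
Proof.
do 3!elim/cancellative_ind => ?.
by rewrite !(to_cancellativeM, to_cancellativeD) mulrDl.
Qed.

Lemma cancellative_mul0 : left_zero [0] cancellative_mul.
Proof. by elim/cancellative_ind => ?; rewrite to_cancellativeM mul0r. Qed.

HB.instance Definition _ := GRing.isNmodule.Build cancellative
  cancellative_addA cancellative_addC cancellative_add0.
HB.instance Definition _ := GRing.Nmodule_isComPzSemiRing.Build cancellative
  cancellative_mulA cancellative_mulC cancellative_mul1 cancellative_mulDl
  cancellative_mul0.

Lemma cancellative_addI (z x y : cancellative) : x + z = y + z -> x = y.
Proof.
elim/cancellative_ind: x => x; elim/cancellative_ind: y => y.
elim/cancellative_ind: z => z.
rewrite -[_ + _]/(cancellative_add _ _) -[RHS]/(cancellative_add _ _).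
rewrite !to_cancellativeD => /to_cancellativeP[u e].
by apply/to_cancellativeP; exists (z + u); rewrite !addrA.
Qed.

End Cancellative.

Section Differences.
Variable S : comPzSemiRingType.
Local Notation C := (cancellative S).

Definition diff_rel (p q : C * C) : bool := p.1 + q.2 == q.1 + p.2.

Lemma diff_rel_refl : reflexive diff_rel.
Proof. by move=> p; exact: eqxx. Qed.

Lemma diff_rel_sym : symmetric diff_rel.
Proof. by move=> p q; exact: eq_sym. Qed.

Lemma diff_rel_trans : transitive diff_rel.
Proof.
move=> q p r /eqP pq /eqP qr; apply/eqP/(@cancellative_addI _ q.2).
by rewrite addrAC pq addrAC qr addrAC.
Qed.

Canonical diff_equiv :=
  EquivRel diff_rel diff_rel_refl diff_rel_sym diff_rel_trans.

Definition groth : Type := {eq_quot diff_rel}.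
HB.instance Definition _ := EqQuotient.on groth.
HB.instance Definition _ := Choice.on groth.

Definition diff (p : C * C) : groth := \pi_groth p.

Lemma diffP p q : diff p = diff q <-> p.1 + q.2 = q.1 + p.2.
Proof. by split=> [/eqmodP/eqP|H] //; apply/eqmodP/eqP. Qed.

Definition groth_add (x y : groth) : groth :=
  diff ((repr x).1 + (repr y).1, (repr x).2 + (repr y).2).
Definition groth_opp (x : groth) : groth := diff ((repr x).2, (repr x).1).
Definition groth_mul (x y : groth) : groth :=
  diff ((repr x).1 * (repr y).1 + (repr x).2 * (repr y).2,
        (repr x).1 * (repr y).2 + (repr x).2 * (repr y).1).

Definition to_groth (x : S) : groth := diff (to_cancellative x, 0).

Lemma groth_repr p : (repr (diff p)).1 + p.2 = p.1 + (repr (diff p)).2.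
Proof. by apply/diffP; exact: reprK. Qed.

Lemma groth_ind (P : groth -> Prop) : (forall p, P (diff p)) -> forall x, P x.
Proof. by move=> H x; rewrite -[x]reprK; exact: H. Qed.

Lemma diffD p q : groth_add (diff p) (diff q) = diff (p.1 + q.1, p.2 + q.2).
Proof. by apply/diffP; rewrite /= addrACA !groth_repr addrACA. Qed.

Lemma diffN p : groth_opp (diff p) = diff (p.2, p.1).
Proof. by apply/diffP; rewrite /= addrC -groth_repr addrC. Qed.

Lemma diffM p q : groth_mul (diff p) (diff q) =
  diff (p.1 * q.1 + p.2 * q.2, p.1 * q.2 + p.2 * q.1).
Proof.
have := groth_repr p; have := groth_repr q; rewrite /groth_mul.
case: p (repr (diff p)) => [a b] [a' b'].
case: q (repr (diff q)) => [c d] [c' d'] /= cd ab.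
transitivity (diff (a * c' + b * d', a * d' + b * c')); apply/diffP => /=.
  transitivity ((a' + b) * c' + (a + b') * d').
    by rewrite !mulrDl [a * d' + b' * d']addrC [RHS]addrACA
      [b * c' + a * d']addrC.
  rewrite ab -{2}ab !mulrDl [LHS]addrACA [RHS]addrACA.
  by congr (_ + _); exact: addrC.
transitivity (a * (c' + d) + b * (c + d')).
  by rewrite !mulrDr [LHS]addrACA; congr (_ + _); exact: addrC.
rewrite cd -{2}cd !mulrDr [RHS]addrACA.
by congr (_ + _); exact: addrC.
Qed.

Lemma groth_addA : associative groth_add.
Proof. by do 3!elim/groth_ind => ?; rewrite !diffD /= !addrA. Qed.

Lemma groth_addC : commutative groth_add.
Proof.
do 2!elim/groth_ind => ?; rewrite !diffD; congr (diff (_, _)); exact: addrC.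
Qed.

Lemma groth_add0 : left_id (diff (0, 0)) groth_add.
Proof. by elim/groth_ind => -[? ?]; rewrite diffD /= !add0r. Qed.

Lemma groth_addN : left_inverse (diff (0, 0)) groth_opp groth_add.
Proof.
elim/groth_ind => -[? ?]; rewrite diffN diffD; apply/diffP => /=.
by rewrite addr0 add0r addrC.
Qed.

Lemma groth_mulA : associative groth_mul.
Proof.
elim/groth_ind => -[a b]; elim/groth_ind => -[c d]; elim/groth_ind => -[e f].
rewrite !diffM /=; congr (diff (_, _)); rewrite !mulrDl !mulrDr !mulrA -!addrA.
  by congr (_ + _); rewrite addrA [LHS]addrC.
by congr (_ + _); rewrite addrA [LHS]addrC.
Qed.

Lemma groth_mulC : commutative groth_mul.
Proof.
elim/groth_ind => -[a b]; elim/groth_ind => -[c d].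
rewrite !diffM /=; congr (diff (_, _)).
  by rewrite [a * c]mulrC [b * d]mulrC.
by rewrite [a * d]mulrC [b * c]mulrC addrC.
Qed.

Lemma groth_mul1 : left_id (diff (1, 0)) groth_mul.
Proof.
by elim/groth_ind => -[a b]; rewrite diffM /= !mul1r !mul0r !addr0.
Qed.

Lemma groth_mulDl : left_distributive groth_mul groth_add.
Proof.
elim/groth_ind => -[a b]; elim/groth_ind => -[c d]; elim/groth_ind => -[e f].
rewrite !(diffD, diffM) /=; congr (diff (_, _)); rewrite !mulrDl;
  exact: addrACA.
Qed.

HB.instance Definition _ := GRing.isZmodule.Build groth
  groth_addA groth_addC groth_add0 groth_addN.
HB.instance Definition _ := GRing.Zmodule_isComPzRing.Build groth
  groth_mulA groth_mulC groth_mul1 groth_mulDl.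

End Differences.

Section K0.
Variables (L : language) (M : structure L) (hM : nontrivial M).

Definition K0 : comPzRingType := groth (Deftilde hM).
Definition K0_class (A : defset M) : K0 := to_groth (dclass hM A).

End K0.

Definition theory (L : language) := set (formula L void).

Definition model L (M : structure L) (T : theory L) : Prop :=
  forall p, T p -> sat p (of_void M).

Definition unary_lang : language :=
  {| funs := unit; fun_arity := fun=> 1%N; rels := void; rel_arity := fun=> 0%N |}.

Section TheoryN.
Variable N : nat.

Definition Tf (V : Type) (t : term unary_lang V) : term unary_lang V :=
  @App unary_lang V tt (fun=> t).

Notation var := (Var unary_lang).

Definition inj_axiom : formula unary_lang void :=
  FAll (FAll (FImp (FEq (Tf (var None)) (Tf (var (Some None))))
                   (FEq (var None) (var (Some None))))).

Definition coimage_axiom : formula unary_lang void :=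
  @FExn _ void N
    (FAnd (\big[@FAnd _ _/FTrue]_(i < N) \big[@FAnd _ _/FTrue]_(j < N | j != i)
             FNot (FEq (var (inr i)) (var (inr j))))
          (FAll (FIff (FNot (FEx (FEq (Tf (var None)) (var (Some None)))))
                      (\big[@FOr _ _/FFalse]_(i < N)
                         FEq (var None) (var (Some (inr i))))))).

Definition acyclic_axiom (n : nat) : formula unary_lang void :=
  FAll (FNot (FEq (iter n (@Tf _) (var None)) (var None))).

Definition theory_T : theory unary_lang :=
  [set p | [\/ p = inj_axiom, p = coimage_axiom |
               exists2 n, (1 <= n)%N & p = acyclic_axiom n]].

End TheoryN.

Section ModelsN.
Variable M : structure unary_lang.

Definition fM (x : M) : M := @fun_interp _ M tt (fun=> x).

Lemma teval_iter V (e : V -> M) n t :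
  teval e (iter n (@Tf V) t) = iter n fM (teval e t).
Proof. by elim: n => //= n ->. Qed.

Lemma sat_coimage_axiom N (e : void -> M) : sat (coimage_axiom N) e <->
  exists y : 'I_N -> M, set_bij [set: 'I_N] (~` range fM) y.
Proof.
split=> [/sat_FExn[y [/sat_bigand yI yP]]|[y [yR yI yS]]].
  have yE m : (~` range fM) m <-> exists i, m = y i.
    have [h h'] := yP m; split=> [m_ni|[i mE]].
      suff /sat_bigor[i _ /= ->] : sat (\big[@FOr _ _/FFalse]_(i < N)
        FEq (Var unary_lang None) (Var unary_lang (Some (inr i))))
        (ocons m (scons e y)) by exists i.
      by apply: h => -[x fx]; apply: m_ni; exists x.
    move=> [x _ fx]; apply: h'; last by exists x.
    by apply/sat_bigor; exists i.
  exists y; split=> [i _|i j _ _ yij|m /yE[i ->]]; last by exists i.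
    by apply/yE; exists i.
  apply/eqP/negPn/negP => ij.
  by have /sat_bigand/(_ j) := yI i isT; rewrite eq_sym => /(_ ij); exact.
apply/sat_FExn; exists y; split.
  apply/sat_bigand => i _; apply/sat_bigand => j ji /= yij.
  by move/eqP: ji; apply; apply: yI; rewrite ?inE.
move=> m; split=> /= [m_ni|/sat_bigor[i _ /= ->] [x fx]].
  have [|i _ <-] := yS m; last by apply/sat_bigor; exists i.
  by move=> [x _ fx]; apply: m_ni; exists x.
by apply: (yR i I); exists x.
Qed.

Lemma model_TP N : model M (theory_T N) <->
  [/\ injective fM,
      exists y : 'I_N -> M, set_bij [set: 'I_N] (~` range fM) y &
      forall n x, (1 <= n)%N -> iter n fM x <> x].
Proof.
split=> [H|[finj fN facyc] p [->|->|[n n1 ->]]].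
- split.
  + by move=> x y; have /(_ y x) := H _ (Or31 _ _ erefl).
  + exact/sat_coimage_axiom/(H _ (Or32 _ _ erefl)).
  + move=> n x n1; have /(_ x) := H _ (Or33 _ _ (ex_intro2 _ _ n n1 erefl)).
    by rewrite /= teval_iter.
- by move=> x y; exact: finj.
- exact/sat_coimage_axiom.
- by move=> x /=; rewrite teval_iter; exact: facyc.
Qed.

Lemma model_T_nontrivial N : model M (theory_T N) -> nontrivial M.
Proof.
move=> /model_TP[_ _ H]; have [x] := nonempty M.
by exists (fM x), x; exact: (H 1%N).
Qed.

End ModelsN.

(** The library type ['Z_N] is [Z/NZ] only for [N > 1]: ['Z_0] and ['Z_1] are
    both [Z/2Z].  Moreover [{poly R}] requires [1 != 0] in [R], so the trivial
    ring [(Z/1Z)[X]] is given by hand. *)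

Definition trivial_ring : Type := unit.
HB.instance Definition _ := Choice.on trivial_ring.

Lemma trivial_ringP (x y : trivial_ring) : x = y.
Proof. by case: x; case: y. Qed.

HB.instance Definition _ := GRing.isZmodule.Build trivial_ring
  (zero := tt) (opp := fun=> tt) (add := fun _ _ => tt)
  (fun _ _ _ => trivial_ringP _ _) (fun _ _ => trivial_ringP _ _)
  (fun _ => trivial_ringP _ _) (fun _ => trivial_ringP _ _).
HB.instance Definition _ := GRing.Zmodule_isComPzRing.Build trivial_ring
  (one := tt) (mul := fun _ _ => tt)
  (fun _ _ _ => trivial_ringP _ _) (fun _ _ => trivial_ringP _ _)
  (fun _ => trivial_ringP _ _) (fun _ _ _ => trivial_ringP _ _).

Definition polyZmod (N : nat) : comPzRingType :=
  match N with
  | 0 => {poly int}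
  | 1 => trivial_ring
  | _ => {poly 'Z_N}
  end.

Definition polyZmodX (N : nat) : polyZmod N :=
  match N with
  | 0 => 'X
  | 1 => tt
  | _.+2 => 'X
  end.

(* Main.v *)
(** Over a ring [R] with [N%:R = 0] and an element [X], functions [M -> R] that
    are constant off a finite set have an integral, normalised so that points
    have mass [1] and [M] has mass [X].  By quantifier elimination the indicator
    of a definable set is a decision tree over atoms [f^k(s) = f^l(t)], and such
    functions are stable under integration in one variable.  Two successive
    integrations commute: by linearity it is enough to consider points, lines and
    graphs of [f^k], and for the last ones the point is that [M] and [f^k(M)]
    have the same mass because [N%:R = 0].  The iterated integral of the
    indicator is thus a multiplicative Euler characteristic, invariant under
    definable bijections by integrating the indicator of the graph in both
    orders; it gives [K0 M -> (Z/NZ)[X]].  Conversely [M = f(M) + N] forces [N = 0]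
    in [K0 M], and cell decomposition shows that [[M]] generates [K0 M], whence
    bijectivity. *)

Require Import Defs.
From Stdlib Require List.
From HB Require Import structures.
From mathcomp Require Import all_boot all_order all_algebra.
From mathcomp Require Import boolp classical_sets functions cardinality fsbigop.

Set Implicit Arguments.
Unset Strict Implicit.
Unset Printing Implicit Defensive.

Import GRing.Theory.
Local Open Scope ring_scope.
Local Open Scope classical_set_scope.

HB.instance Definition _ (L : language) (M : structure L) := gen_eqMixin M.
HB.instance Definition _ (L : language) (M : structure L) := gen_choiceMixin M.

(** * Simple functions *)

Section SimpleFunctions.
Variable M : structure unary_lang.
Local Notation f := (@fM M).
Local Notation val x s := (scons x id s).

Definition upd (V : Type) (x : V -> M) (v : V) (m : M) : V -> M :=
  fun w => if `[< w = v >] then m else x w.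

Lemma upd_same V (x : V -> M) v m : upd x v m v = m.
Proof. by rewrite /upd asboolT. Qed.

Lemma upd_other V (x : V -> M) v m w : w <> v -> upd x v m w = x w.
Proof. by move=> wv; rewrite /upd asboolF. Qed.

Lemma val_upd V (x : V -> M) v m (t : V + M) :
  t <> inl v -> val (upd x v m) t = val x t.
Proof. by case: t => //= w wv; apply: upd_other => e; apply: wv; rewrite e. Qed.

(** With a single unary symbol, every term is an iterate of [f] at a variable or a parameter, so
    these are all the equations between terms. *)
Definition atom (V : Type) (k l : nat) (s t : V + M) (x : V -> M) : bool :=
  `[< iter k f (val x s) = iter l f (val x t) >].

(** Decision trees over atoms. *)
Inductive simple (V T : Type) : ((V -> M) -> T) -> Prop :=
| simple_const c : simple (fun=> c)
| simple_if k l s t F G : simple F -> simple G ->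
    simple (fun x => if atom k l s t x then F x else G x).

Lemma simple_ext V T (F G : (V -> M) -> T) : F =1 G -> simple F -> simple G.
Proof. by move=> /funext ->. Qed.

Lemma simple_comp V T U (h : T -> U) (F : (V -> M) -> T) :
  simple F -> simple (fun x => h (F x)).
Proof.
elim=> [c|k l s t {}F G _ hF _ hG]; first exact: simple_const.
by apply: simple_ext (simple_if k l s t hF hG) => x /=; case: ifP.
Qed.

Lemma simple_comp2 V T1 T2 U (h : T1 -> T2 -> U) (F : (V -> M) -> T1) G :
  simple F -> simple G -> simple (fun x => h (F x) (G x)).
Proof.
move=> sF sG; elim: sF => [c|k l s t {}F F' _ hF _ hF'].
  exact: (simple_comp (h c) sG).
by apply: simple_ext (simple_if k l s t hF hF') => x /=; case: ifP.
Qed.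

Lemma simple_atom V k l (s t : V + M) : simple (atom k l s t).
Proof.
apply: simple_ext
  (simple_if k l s t (simple_const _ true) (simple_const _ false)).
by move=> x; case: ifP.
Qed.

Lemma simple_ite V T (b : (V -> M) -> bool) (F G : (V -> M) -> T) :
  simple b -> simple F -> simple G -> simple (fun x => if b x then F x else G x).
Proof.
move=> sb sF sG.
exact: (simple_comp2 (fun (p : bool) q => if p then q.1 else q.2) sb
  (simple_comp2 pair sF sG)).
Qed.

Lemma simple_all V I (r : seq I) (b : I -> (V -> M) -> bool) :
  (forall i, simple (b i)) -> simple (fun x => all (b^~ x) r).
Proof.
move=> sb; elim: r => [|i r IH] /=; first exact: simple_const.
exact: simple_comp2.
Qed.

Lemma simple_subst V W T (g : V -> W + M) (F : (V -> M) -> T) :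
  simple F -> simple (fun x : W -> M => F (fun v => val x (g v))).
Proof.
pose gs (s : V + M) := match s with inl v => g v | inr m => inr m end.
have gE (x : W -> M) s : val (fun v => val x (g v)) s = val x (gs s) by case: s.
elim=> [c|k l s t {}F G _ hF _ hG]; first exact: simple_const.
apply: simple_ext (simple_if k l (gs s) (gs t) hF hG) => x.
by rewrite /atom !gE.
Qed.

Lemma definable_atom V k l (s t : V + M) : definable [set x | atom k l s t x].
Proof.
exists (FEq (iter k (@Tf _) (Var _ s)) (iter l (@Tf _) (Var _ t))).
apply/seteqP; split=> x /=; rewrite !teval_iter /=.
  by move/asboolP.
by move=> e; apply/asboolP.
Qed.

Lemma definable_simple V (b : (V -> M) -> bool) :
  simple b -> definable [set x | b x].
Proof.
elim=> [c|k l s t F G _ hF _ hG].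
  case: c.
    by congr definable: (definableT M V); apply/seteqP; split.
  by congr definable: (definable0 M V); apply/seteqP; split.
have da := definable_atom k l s t.
congr definable: (definableU (definableI da hF) (definableI (definableC da) hG)).
apply/seteqP; split=> x /=; case: (atom _ _ _ _ x).
- by case=> -[].
- by case=> -[].
- by left.
- by right.
Qed.

End SimpleFunctions.


(** * Grothendieck rings *)

Section GrothendieckExtension.
Variable S : comPzSemiRingType.

Lemma to_grothD : {morph @to_groth S : x y / x + y}.
Proof.
move=> x y; rewrite -[RHS]/(groth_add _ _) diffD /= addr0.
by rewrite -[X in diff (X, _)]/(cancellative_add _ _) to_cancellativeD.
Qed.

Lemma to_grothM : {morph @to_groth S : x y / x * y}.
Proof.
move=> x y; rewrite -[RHS]/(groth_mul _ _) diffM /= mulr0 !mul0r !addr0.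
by rewrite mulr0 -[X in diff (X, _)]/(cancellative_mul _ _) to_cancellativeM.
Qed.

Lemma to_groth1 : to_groth (1 : S) = 1.
Proof. by []. Qed.

Lemma grothP (z : groth S) : exists x y : S, z = to_groth x - to_groth y.
Proof.
elim/groth_ind: z => -[a b].
elim/cancellative_ind: a => x; elim/cancellative_ind: b => y.
exists x, y; rewrite -[RHS]/(groth_add _ (groth_opp _)) diffN diffD /=.
by rewrite addr0 add0r.
Qed.

(** The universal property of the Grothendieck ring. Addition in [R] is cancellative, so [h]
    descends to the cancellative quotient; it then extends to formal differences by subtraction. *)
Lemma groth_extend (R : comPzRingType) (h : S -> R) : h 1 = 1 ->
  {morph h : x y / x + y} -> {morph h : x y / x * y} ->
  exists phi : {rmorphism groth S -> R}, forall x, phi (to_groth x) = h x.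
Proof.
move=> h1 hD hM.
have h0 : h 0 = 0 by apply: (addrI (h 0)); rewrite -hD !addr0.
pose hc (x : cancellative S) : R := h (repr x).
have hcE x : hc (to_cancellative x) = h x.
  by have [z e] := cancellative_repr x; apply: (addIr (h z)); rewrite -!hD e.
have hcD : {morph hc : x y / x + y}.
  elim/cancellative_ind => x; elim/cancellative_ind => y.
  by rewrite -[_ + _]/(cancellative_add _ _) to_cancellativeD !hcE hD.
have hcM : {morph hc : x y / x * y}.
  elim/cancellative_ind => x; elim/cancellative_ind => y.
  by rewrite -[_ * _]/(cancellative_mul _ _) to_cancellativeM !hcE hM.
pose g (z : groth S) : R := hc (repr z).1 - hc (repr z).2.
have gE p : g (diff p) = hc p.1 - hc p.2.
  have /(congr1 hc) := groth_repr p; rewrite !hcD /g => e.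
  by apply: (addIr (hc p.2)); rewrite addrAC e subrK addrK.
have gB : {morph g : x y / x - y}.
  elim/groth_ind => p; elim/groth_ind => q.
  rewrite -[_ - _]/(groth_add _ (groth_opp _)) diffN diffD !gE /= !hcD.
  by rewrite !opprD opprK addrACA [in RHS](addrC (- hc q.1)).
have g1 : g 1 = 1.
  by rewrite -to_groth1 gE /= !hcE h1 h0 subr0.
have gM : {morph g : x y / x * y}.
  elim/groth_ind => p; elim/groth_ind => q.
  rewrite -[_ * _]/(groth_mul _ _) diffM !gE /= !hcD !hcM.
  rewrite [RHS]mulrBr !mulrBl opprB [RHS]addrACA opprD.
  by congr (_ + _); rewrite addrC.
pose phi : {rmorphism groth S -> R} := HB.pack g
  (GRing.isZmodMorphism.Build _ _ g gB)
  (GRing.isMonoidMorphism.Build _ _ g (g1, gM)).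
exists phi => x; rewrite -[LHS]/(g _) gE /=.
by rewrite !hcE h0 subr0.
Qed.

End GrothendieckExtension.

(** * Classes of definable sets in the Grothendieck ring *)

Section Classes.
Variables (L : language) (M : structure L) (hM : nontrivial M).

(** Total in [A], with the value [0] when [A] is not definable. *)
Definition kclass n (A : set ('I_n -> M)) : K0 hM :=
  if pselect (definable A) is left dA then K0_class hM (DefSet dA) else 0.

Lemma kclassE (A : defset M) : kclass (dset A) = K0_class hM A.
Proof.
rewrite /kclass; case: pselect => [dA|[]]; last exact: dsetP.
by congr to_groth; apply/dclassP; exact: definable_bij_refl.
Qed.

Lemma kclass_bij m n (A : set ('I_m -> M)) (B : set ('I_n -> M)) :
  definable A -> definable B -> definable_bij A B -> kclass A = kclass B.
Proof.
move=> dA dB AB; rewrite (kclassE (DefSet dA)) (kclassE (DefSet dB)).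
by congr to_groth; apply/dclassP.
Qed.

Lemma kclassU n (A B : set ('I_n -> M)) : definable A -> definable B ->
  A `&` B = set0 -> kclass (A `|` B) = kclass A + kclass B.
Proof.
move=> dA dB AB; rewrite (kclassE (DefSet dA)) (kclassE (DefSet dB)).
rewrite (kclassE (DefSet (definableU dA dB))) -to_grothD.
by congr to_groth; exact: dclassU.
Qed.

Lemma kclassX m n (A : set ('I_m -> M)) (B : set ('I_n -> M)) :
  definable A -> definable B -> kclass (prod_set A B) = kclass A * kclass B.
Proof.
move=> dA dB; rewrite (kclassE (DefSet dA)) (kclassE (DefSet dB)).
rewrite (kclassE (dprod (DefSet dA) (DefSet dB))) -to_grothM.
by congr to_groth; rewrite -dclassM.
Qed.

Lemma kclass0 n : kclass (@set0 ('I_n -> M)) = 0.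
Proof.
have d0 := definable0 M 'I_n.
have := kclassU d0 d0 (setI0 _); rewrite setU0 => e.
by apply: (addrI (kclass (@set0 ('I_n -> M)))); rewrite addr0 -e.
Qed.

Lemma kclass_power0 : kclass [set: 'I_0 -> M] = 1.
Proof. by rewrite (kclassE (dpower M 0)). Qed.

Lemma kclass_split n (A B : set ('I_n -> M)) : definable A -> definable B ->
  kclass A = kclass (A `&` B) + kclass (A `&` ~` B).
Proof.
move=> dA dB; rewrite -kclassU.
- by rewrite -setIUr setUv setIT.
- exact: definableI.
- by apply: definableI => //; exact: definableC.
- by rewrite setIACA setICr setI0.
Qed.

End Classes.
(** * Quantifier elimination *)

Section Model.
Variables (M : structure unary_lang) (N : nat) (c : 'I_N -> M).
Local Notation f := (@fM M).
Local Notation val x s := (scons x id s).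
Hypothesis f_inj : injective f.
Hypothesis c_bij : set_bij [set: 'I_N] (~` range f) c.
Hypothesis f_acyclic : forall n x, (1 <= n)%N -> iter n f x <> x.

Lemma iterf_inj k : injective (iter k f).
Proof. by elim: k => // k IH x y /f_inj/IH. Qed.

(** Cancelling the smaller power of [f] leaves a point fixed by a power of [f], which acyclicity
    allows only for the exponent [0]. *)
Lemma iterf_eq k l x : iter k f x = iter l f x -> k = l.
Proof.
wlog kl : k l / (k <= l)%N => [H e|].
  by case/orP: (leq_total k l) => h; [exact: H|exact/esym/H].
rewrite -{1}(subnKC kl) iterD => /iterf_inj e.
case: (posnP (l - k)) => [/eqP|h]; last by case: (f_acyclic h (esym e)).
by rewrite subn_eq0 => lk; apply/eqP; rewrite eqn_leq kl.
Qed.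

Lemma c_inj : injective c.
Proof. by case: c_bij => _ ci _ i j e; apply: ci; rewrite ?inE. Qed.

(** [M] is infinite because orbits of [f] never repeat. Generic witnesses for quantifiers and the
    uniqueness of a generic value both rest on this. *)
Lemma exists_notin (r : seq M) : exists m, m \notin r.
Proof.
case: (pselect (exists m, m \notin r)) => // /forallNP H.
have [x] := Defs.nonempty M.
pose s := [seq iter n f x | n <- iota 0 (size r).+1].
have us : uniq s.
  rewrite map_inj_in_uniq ?iota_uniq // => k l _ _; exact: iterf_eq.
have /(uniq_leq_size us) : {subset s <= r}.
  by move=> m _; apply/negPn/negP; exact: H.
by rewrite size_map size_iota ltnn.
Qed.

(** Undoing [f] one step at a time shows that [f^k] misses exactly the points [f^j(c i)] with
    [j < k]. Solvability of an equation in one unknown thus becomes a finite conjunction of negated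
    atoms. *)
Lemma iterf_rangeP k m :
  (exists y, iter k f y = m) <-> forall j i, (j < k)%N -> m <> iter j f (c i).
Proof.
have [cR _ cS] := c_bij.
elim: k m => [|k IH] m; first by split=> // _; exists m.
split=> [[y <-] j i jk|H].
  rewrite -(subnKC jk) addSnnS iterD => /iterf_inj /=.
  by move=> e; apply: (cR i I); exists (iter (k - j) f y).
have /IH[y ym] : forall j i, (j < k)%N -> m <> iter j f (c i).
  by move=> j i jk; apply: H; apply: ltnW.
case: (pselect (range f y)) => [[z _ zy]|/cS[i _ iy]].
  by exists z; rewrite iterSr zy.
by case: (H k i) => //; rewrite iy.
Qed.

Definition solvable_at V k l (t : V + M) (x : V -> M) : bool :=
  `[< exists m, iter k f m = iter l f (val x t) >].

Lemma simple_solvable V k l (t : V + M) : simple (solvable_at k l t).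
Proof.
apply: (simple_ext (F := fun x => all (fun j => all (fun i =>
   ~~ atom l j t (inr (c i)) x) (enum 'I_N)) (iota 0 k))).
  move=> x; apply/idP/asboolP.
    move=> /allP H; apply/iterf_rangeP => j i jk e.
    have : j \in iota 0 k by rewrite mem_iota.
    by move=> /H/allP/(_ i); rewrite mem_enum => /(_ isT) /asboolP; apply.
  move=> /iterf_rangeP H; apply/allP => j; rewrite mem_iota => /= jk.
  by apply/allP => i _; apply/asboolP; exact: H.
apply: simple_all => j; apply: simple_all => i.
exact/simple_comp/simple_atom.
Qed.

(** If [v] occurs on both sides, acyclicity reduces the atom to an equality of exponents; if it
    occurs on one side only, the atom can be oriented as an equation for [v]. *)
Lemma atom_cases V k l (s t : V + M) (v : V) :
  (forall x m, atom k l s t (upd x v m) = atom k l s t x) \/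
  exists k' l' t', t' <> inl v /\
    forall x, atom k l s t x = atom k' l' (inl v) t' x.
Proof.
have C k' l' s' t' x : atom k' l' s' t' x = atom l' k' t' s' x :> bool.
  by apply/asboolP/asboolP => ->.
case: (pselect (s = inl v)) => [->|sv].
  case: (pselect (t = inl v)) => [->|tv]; last by right; exists k, l, t.
  left=> x m; apply/asboolP/asboolP => /= /iterf_eq -> //.
case: (pselect (t = inl v)) => [->|tv]; last first.
  by left=> x m; rewrite /atom !val_upd.
by right; exists l, k, s; split=> // x; rewrite C.
Qed.

(** The solution need not be a term in [x], so it cannot be substituted directly. Instead the
    injective [f^k] is applied to both sides of an atom in [v], after which [f^k(m)] is replaced by
    [f^l(t)]. *)
Lemma simple_solve V T (F : (V -> M) -> T) v k l t :
  simple F -> t <> inl v -> exists2 G, simple G &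
  forall x m, iter k f m = iter l f (val x t) -> F (upd x v m) = G x.
Proof.
move=> sF tv.
elim: sF => [a|k' l' s' t' {}F F' _ [G sG GP] _ [G' sG' GP']].
  by exists (fun=> a) => //; exact: simple_const.
suff [b sb bP] : exists2 b : (V -> M) -> bool, simple b & forall x m,
    iter k f m = iter l f (val x t) -> atom k' l' s' t' (upd x v m) = b x.
  exists (fun x => if b x then G x else G' x); first exact: simple_ite.
  by move=> x m e; rewrite (bP _ _ e) (GP _ _ e) (GP' _ _ e).
case: (atom_cases k' l' s' t' v) => [H|[k1 [l1 [t1 [t1v H]]]]].
  exists (atom k' l' s' t'); first exact: simple_atom.
  by move=> x m _; rewrite H.
exists (atom (k1 + l) (k + l1) t t1); first exact: simple_atom.
move=> x m e; rewrite H /atom (val_upd _ _ t1v) /= upd_same.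
have -> : iter (k1 + l) f (val x t) = iter k f (iter k1 f m).
  by rewrite iterD -e -!iterD addnC.
rewrite [iter (k + l1) f _]iterD.
by apply/asboolP/asboolP => [->|/iterf_inj].
Qed.

(** Outside finitely many solution sets, [F] does not depend on [v]. *)
Lemma simple_generic V T (F : (V -> M) -> T) v : simple F ->
  exists G (r : seq (nat * nat * (V + M))), [/\ simple G,
    forall p, List.In p r -> p.2 <> inl v &
    forall x m,
      ~~ has (fun p => `[< iter p.1.1 f m = iter p.1.2 f (val x p.2) >]) r ->
      F (upd x v m) = G x].
Proof.
elim=> [a|k l s t {}F F' sF [G [r [sG rv GP]]] sF' [G' [r' [sG' rv' GP']]]].
  by exists (fun=> a), [::]; split=> //; exact: simple_const.
have rr p : List.In p (r ++ r') -> p.2 <> inl v.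
  by move=> /(@List.in_app_or _ r r' p)[]; [exact: rv|exact: rv'].
case: (atom_cases k l s t v) => [H|[k1 [l1 [t1 [t1v H]]]]].
  exists (fun x => if atom k l s t x then G x else G' x), (r ++ r').
  split=> //; first exact: simple_if.
  by move=> x m; rewrite has_cat H => /norP[/GP -> /GP' ->].
(* The atom holds only on the solution set now added to the list, so the generic value is that of
   the negative branch. *)
exists G', ((k1, l1, t1) :: r ++ r'); split=> //.
  by move=> p /= [<-//|/rr].
move=> x m; rewrite -[has _ _]/(_ || has _ (r ++ r')) has_cat.
move=> /norP[/negbTE e /norP[_ /GP' E]].
by rewrite H /atom (val_upd _ _ t1v) /= upd_same e E.
Qed.

(** A witness is either generic, and then [b] takes the value [G x], or it solves one of the
    finitely many equations in [r], and then [v] is eliminated by [simple_solve]. *)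
Lemma simple_exists V (b : (V -> M) -> bool) v : simple b ->
  simple (fun x => `[< exists m, b (upd x v m) >]).
Proof.
move=> sb; have [G [r [sG rv GP]]] := simple_generic v sb.
pose B (p : nat * nat * (V + M)) x :=
  `[< exists m, iter p.1.1 f m = iter p.1.2 f (val x p.2) /\ b (upd x v m) >].
have sB p : List.In p r -> simple (B p).
  move=> /rv pv; have [G' sG' GP'] := simple_solve p.1.1 p.1.2 sb pv.
  apply: (simple_ext (F := fun x => solvable_at p.1.1 p.1.2 p.2 x && G' x)).
    move=> x; apply/andP/asboolP.
      by move=> [/asboolP[m e] g]; exists m; rewrite (GP' _ _ e).
    move=> [m [e g]]; rewrite -(GP' _ _ e); split=> //.
    by apply/asboolP; exists m.
  by apply: simple_comp2 => //; exact: simple_solvable.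
have sH : simple (fun x => has (B^~ x) r).
  elim: (r) sB => [|p r' IH] sB /=; first exact: simple_const.
  apply: (simple_comp2 orb); first by apply: sB; left.
  by apply: IH => q qr; apply: sB; right.
apply: simple_ext (simple_comp2 orb sG sH) => x.
have hasP p (P : pred _) : List.In p r -> P p -> has P r.
  elim: (r) => //= q r' IH [->->//|/IH h /h ->]; exact: orbT.
have hasE (P : pred _) : has P r -> exists2 p, List.In p r & P p.
  elim: (r) => //= q r' IH /orP[|/IH[p]]; first by exists q; first left.
  by exists p; first right.
apply/orP/asboolP.
  case=> [g|/hasE[p _ /asboolP[m [_ bm]]]]; last by exists m.
  (* Each equation has at most one solution since iterates of [f] are injective, so a finite list
     contains all exceptional points. *)
  have fin : exists l : seq M, forall m, m \notin l ->
      ~~ has (fun p => `[< iter p.1.1 f m = iter p.1.2 f (val x p.2) >]) r.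
    elim: (r) => [|p r' [l lP]]; first by exists [::].
    case: (pselect (exists m, iter p.1.1 f m = iter p.1.2 f (val x p.2))).
      move=> [m0 e0]; exists (m0 :: l) => m; rewrite inE => /norP[m0m /lP h].
      apply/norP; split=> //; apply/asboolP.
      by rewrite -e0 => /iterf_inj e; rewrite e eqxx in m0m.
    move=> ne; exists l => m /lP h; apply/norP; split=> //.
    by apply/asboolP => e; apply: ne; exists m.
  have [l lP] := fin; have [m /lP/GP e] := exists_notin l.
  by exists m; rewrite e.
move=> [m bm].
case: (boolP (has (fun p => `[< iter p.1.1 f m = iter p.1.2 f (val x p.2) >]) r)).
  move=> /hasE[p pr /asboolP e]; right; apply: (hasP p) => //.
  by apply/asboolP; exists m.
by move=> /GP e; left; rewrite -e.
Qed.

(** Decision trees are closed under Boolean operations and, by [simple_exists], under an existential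
    quantifier; a universal one is handled by negation. This is quantifier elimination. *)
Lemma simple_sat V (p : formula unary_lang V) :
  simple (fun x : V -> M => `[< sat p x >]).
Proof.
have term_val U (t : term unary_lang U) :
    exists k v, forall e : U -> M, teval e t = iter k f (e v).
  elim: t => [v|[] a IH]; first by exists 0%N, v.
  have [k [v kv]] := IH ord0; exists k.+1, v => e /=; rewrite -kv /fM.
  by congr fun_interp; apply: funext => i; congr (teval e (a _)); rewrite ord1.
have sEx U (q : formula unary_lang (option U)) :
    simple (fun x : option U -> M => `[< sat q x >]) ->
    simple (fun x : U -> M => `[< exists m, sat q (ocons m x) >]).
  move=> /(simple_exists None).
  (* Elimination leaves a function that formally still takes the bound variable [None]; evaluating
     it at an arbitrary [m0] gives a function on assignments of [U]. *)
  have [m0] := Defs.nonempty M; pose g (o : option U) : U + M :=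
    if o is Some u then inl u else inr m0.
  move=> /(simple_subst g); apply: simple_ext => x.
  have E m : upd (fun o => val x (g o)) None m = ocons m x.
    apply: funext => -[u|]; last by rewrite upd_same.
    by rewrite upd_other.
  by apply: asbool_equiv_eq; split=> -[m]; rewrite ?E => h; exists m;
    [exact/asboolP|rewrite E; exact/asboolP].
elim: p => {V} [V|V t u|V []|V p IHp q IHq|V p IHp q IHq|V p IHp q IHq
  |V p IH|V p IH] /=.
- exact: simple_const.
- have [k [v kv]] := term_val _ t; have [l [w lw]] := term_val _ u.
  apply: simple_ext (simple_atom k l (inl v) (inl w)) => x.
  by rewrite /atom /= kv lw.
- by apply: simple_ext (simple_comp2 andb IHp IHq) => x; rewrite asbool_and.
- by apply: simple_ext (simple_comp2 orb IHp IHq) => x; rewrite asbool_or.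
- apply: simple_ext (simple_comp2 implb IHp IHq) => x.
  apply/implyP/asboolP => h; last by move=> /asboolP/h hq; apply/asboolP.
  by move=> hp; apply/asboolP/h/asboolP.
- exact: sEx.
- have sN : simple (fun x : option V -> M => `[< sat (FNot p) x >]).
    apply: simple_ext (simple_comp negb IH) => x /=.
    apply/negP/asboolP => h; last by move=> /asboolP.
    by move=> s; apply: h; apply/asboolP.
  apply: simple_ext (simple_comp negb (sEx _ _ sN)) => x; apply/negP/asboolP.
    move=> h m; apply: contrapT => n; apply: h; apply/asboolP; exists m.
    exact: n.
  by move=> h /asboolP[m]; apply; exact: h.
Qed.

Lemma simple_definable V (A : set (V -> M)) :
  definable A -> simple (fun x => `[< A x >]).
Proof. by move=> [p ->]; exact: (simple_subst id (simple_sat p)). Qed.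


(** * Integration and the Euler characteristic *)

Section Integral.
Variables (R : comPzRingType) (X : R).
Hypothesis N0 : N%:R = 0 :> R.

(** The list may be larger than necessary, which lets two functions share the same one. *)
Definition almost_const_off (r : seq M) (h : M -> R) (g : R) : Prop :=
  uniq r /\ forall m, m \notin r -> h m = g.

Definition almost_const (h : M -> R) : Prop :=
  exists r g, almost_const_off r h g.

(** The linear functional on almost constant functions sending the indicator of
    a point to [1] and the constant [1] to [X]; its value on other functions is
    meaningless. *)
Definition integ (h : M -> R) : R :=
  let g := xget 0 [set g | exists r, almost_const_off r h g] in
  g * X + \sum_(m \in [set: M]) (h m - g).

(** The generic value is unique since [M] is infinite, so the value selected by [xget] is [g]. *)
Lemma integE r h g : almost_const_off r h g ->
  integ h = g * X + \sum_(m <- r) (h m - g).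
Proof.
move=> [ur rP]; rewrite /integ (_ : xget _ _ = g); last first.
  apply: xget_unique => [|g' [r' [_ r'P]]]; first by exists r.
  have [m] := exists_notin (r ++ r'); rewrite mem_cat => /norP[mr mr'].
  by rewrite -(rP _ mr) -(r'P _ mr').
congr (_ + _); rewrite (fsbigE r) //.
  by apply: eq_bigl => m; rewrite in_setT.
by move=> m _ /rP ->; rewrite subrr.
Qed.

Lemma almost_const_widen r r' h g :
  almost_const_off r h g -> almost_const_off (undup (r ++ r')) h g.
Proof.
move=> [_ rP]; split=> [|m]; first exact: undup_uniq.
by rewrite mem_undup mem_cat => /norP[/rP].
Qed.

Lemma almost_const_common h h' : almost_const h -> almost_const h' ->
  exists r g g', almost_const_off r h g /\ almost_const_off r h' g'.
Proof.
move=> [r [g hg]] [r' [g' hg']]; exists (undup (r ++ r')), g, g'.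
split; first exact: almost_const_widen.
split=> [|m]; first exact: undup_uniq.
by rewrite mem_undup mem_cat => /norP[_]; exact: hg'.2.
Qed.

Lemma almost_const_cst a : almost_const (fun=> a).
Proof. by exists [::], a. Qed.

Lemma integ_cst a : integ (fun=> a) = a * X.
Proof.
by rewrite (@integE [::] _ a) ?big_nil ?addr0 //; split.
Qed.

Lemma almost_const_point p (a : R) : almost_const (fun m => if m == p then a else 0).
Proof. by exists [:: p], 0; split=> // m; rewrite inE => /negbTE ->. Qed.

Lemma integ_point p (a : R) : integ (fun m => if m == p then a else 0) = a.
Proof.
rewrite (@integE [:: p] _ 0).
  by rewrite big_seq1 eqxx subr0 mul0r add0r.
by split=> // m; rewrite inE => /negbTE ->.
Qed.

Lemma almost_constD h h' : almost_const h -> almost_const h' ->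
  almost_const (fun m => h m + h' m).
Proof.
move=> ch /(almost_const_common ch)[r [g [g' [[ur rP] [_ rP']]]]].
by exists r, (g + g'); split=> // m mr; rewrite rP ?rP'.
Qed.

Lemma integD h h' : almost_const h -> almost_const h' ->
  integ (fun m => h m + h' m) = integ h + integ h'.
Proof.
move=> ch /(almost_const_common ch)[r [g [g' [c1 c2]]]].
rewrite (integE c1) (integE c2) (@integE r _ (g + g')); last first.
  by case: c1 c2 => ur rP [_ rP']; split=> // m mr; rewrite rP ?rP'.
rewrite mulrDl addrACA -big_split; congr (_ + _); apply: eq_bigr => m _ /=.
by rewrite opprD addrACA.
Qed.

Lemma almost_constZ a h : almost_const h -> almost_const (fun m => a * h m).
Proof.
move=> [r [g [ur rP]]].
by exists r, (a * g); split=> // m mr; rewrite rP.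
Qed.

Lemma integZ a h : almost_const h -> integ (fun m => a * h m) = a * integ h.
Proof.
move=> [r [g c1]]; rewrite (integE c1) (@integE r _ (a * g)); last first.
  by case: c1 => ur rP; split=> // m mr; rewrite rP.
rewrite mulrDr mulrA mulr_sumr; congr (_ + _); apply: eq_bigr => m _ /=.
by rewrite mulrBr.
Qed.

Lemma almost_constB h h' : almost_const h -> almost_const h' ->
  almost_const (fun m => h m - h' m).
Proof.
move=> c1 c2; have := almost_constD c1 (almost_constZ (-1) c2).
by under eq_fun do rewrite mulN1r.
Qed.

Lemma integB h h' : almost_const h -> almost_const h' ->
  integ (fun m => h m - h' m) = integ h - integ h'.
Proof.
move=> c1 c2; rewrite -[- integ h']mulN1r -integZ // -integD //.
  by under [in RHS]eq_fun do rewrite mulN1r.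
exact: almost_constZ.
Qed.

(** The complement of [f^k(M)] has [k * N] elements: this is the only place where
    [N%:R = 0] in [R] is needed. *)
Lemma integ_range k (a : R) :
  let h m := if `[< exists y, iter k f y = m >] then a else 0 in
  almost_const h /\ integ h = a * X.
Proof.
have [cR _ cS] := c_bij.
elim: k => [|k [ch ih]] /=.
  have -> : (fun m : M => if `[< exists y : M, y = m >] then a else 0) = (fun=> a).
    by apply: funext => m; rewrite asboolT //; exists m.
  by split; [exact: almost_const_cst|exact: integ_cst].
(* [d] is [a] times the indicator of the [N] points [f^k(c i)], which lie in the image of [f^k] but
   not in that of [f^(k+1)]. Its integral is [a] times [N], hence [0]. *)
pose d m := \sum_(i < N) (if m == iter k f (c i) then a else 0).
have dP (r : seq 'I_N) :
    almost_const (fun m => \sum_(i <- r) (if m == iter k f (c i) then a else 0)) /\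
    integ (fun m => \sum_(i <- r) (if m == iter k f (c i) then a else 0)) =
      \sum_(i <- r) a.
  elim: r => [|i r [c1 i1]].
    under eq_fun do rewrite big_nil.
    split; first exact: almost_const_cst.
    by rewrite big_nil -[RHS](mul0r X) -integ_cst.
  under eq_fun do rewrite big_cons.
  split; first by apply: almost_constD => //; exact: almost_const_point.
  rewrite integD //; last exact: almost_const_point.
  by rewrite integ_point i1 big_cons.
have [cd id] : almost_const d /\ integ d = 0.
  have [cd id] := dP (index_enum 'I_N); split=> //.
  by rewrite id sumr_const card_ord -mulr_natr N0 mulr0.
have -> : (fun m : M => if `[< exists y, f (iter k f y) = m >] then a else 0) =
    (fun m => (if `[< exists y, iter k f y = m >] then a else 0) - d m).
  apply: funext => m; case: (pselect (exists i, m = iter k f (c i))).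
    move=> [i mi]; rewrite asboolF; last first.
      move=> [y]; rewrite mi -iterS iterSr => /iterf_inj e.
      by apply: (cR i I); exists y.
    rewrite asboolT; last by exists (c i).
    rewrite /d (bigD1 i) //= -mi eqxx big1 ?addr0 ?subrr // => j ji.
    by case: eqP => //; rewrite mi => /iterf_inj/c_inj e; rewrite e eqxx in ji.
  move=> ni; rewrite /d big1 ?subr0 => [|i _]; last first.
    by case: eqP => // e; case: ni; exists i.
  congr (if _ then _ else _); apply: asbool_equiv_eq; split=> -[y].
    by rewrite -iterS iterSr => <-; exists (f y).
  move=> ym; case: (pselect (range f y)) => [[z _ zy]|/cS[i _ iy]].
    by exists z; rewrite -iterS iterSr zy.
  by case: ni; exists i; rewrite iy.
by split; [exact: almost_constB|rewrite integB // ih id subr0].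
Qed.

(** An atom that is an equation for [v] holds for at most one value of [v]. The integral is
    therefore that of [F'], corrected at that value, when it exists, by the difference of the two
    branches. *)
Lemma simple_fiber V (F : (V -> M) -> R) v : simple F ->
  (forall x, almost_const (fun m => F (upd x v m))) /\
  simple (fun x => integ (fun m => F (upd x v m))).
Proof.
elim=> [a|k l s t {}F F' sF [cF iF] sF' [cF' iF']].
  split=> [x|]; first exact: almost_const_cst.
  by rewrite integ_cst; exact: simple_const.
case: (atom_cases k l s t v) => [H|[k1 [l1 [t1 [t1v H]]]]].
  split=> [x|].
    by under eq_fun do rewrite H; case: (atom k l s t x).
  apply: simple_ext (simple_if k l s t iF iF') => x /=.
  by under [in RHS]eq_fun do rewrite H; case: (atom k l s t x).
have [G sG GP] := simple_solve k1 l1 sF t1v.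
have [G' sG' GP'] := simple_solve k1 l1 sF' t1v.
have main x : almost_const (fun m =>
      if atom k l s t (upd x v m) then F (upd x v m) else F' (upd x v m)) /\
    integ (fun m =>
      if atom k l s t (upd x v m) then F (upd x v m) else F' (upd x v m)) =
    if solvable_at k1 l1 t1 x then integ (fun m => F' (upd x v m)) + (G x - G' x)
    else integ (fun m => F' (upd x v m)).
  case: ifP => [/asboolP[p pe]|/asboolP ns].
    have -> : (fun m : M =>
       if atom k l s t (upd x v m) then F (upd x v m) else F' (upd x v m)) =
       (fun m => F' (upd x v m) + (if m == p then G x - G' x else 0)).
      apply: funext => m; rewrite H /atom (val_upd _ _ t1v) /= upd_same -pe.
      case: eqP => [->|mp].
        by rewrite asboolT // (GP _ _ pe) (GP' _ _ pe) addrC subrK.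
      by rewrite asboolF ?addr0 // => /iterf_inj.
    split; first by apply: almost_constD => //; exact: almost_const_point.
    by rewrite integD ?integ_point //; exact: almost_const_point.
  have -> : (fun m : M =>
       if atom k l s t (upd x v m) then F (upd x v m) else F' (upd x v m)) =
       (fun m => F' (upd x v m)).
    apply: funext => m; rewrite H /atom (val_upd _ _ t1v) /= upd_same asboolF //.
    by move=> e; apply: ns; exists m.
  by [].
split=> [x|]; first exact: (main x).1.
apply: (simple_ext (fun x => esym (main x).2)).
apply: simple_ite => //; first exact: simple_solvable.
by apply: (simple_comp2 +%R iF'); exact: (simple_comp2 (fun a b => a - b) sG sG').
Qed.

(** In two variables, the nontrivial atoms are the curves; by acyclicity two
    distinct curves meet in at most one point, so that every conjunction of
    atoms is [flat]. *)
Inductive curve (P : M -> M -> Prop) : Prop :=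
| Vline p of forall a b, P a b <-> a = p
| Hline p of forall a b, P a b <-> b = p
| Graph k of forall a b, P a b <-> b = iter k f a
| Cograph k of forall a b, P a b <-> a = iter k f b.

Inductive flat (P : M -> M -> Prop) : Prop :=
| FlatAll of forall a b, P a b
| FlatSub of forall a b a' b', P a b -> P a' b' -> a = a' /\ b = b'
| FlatCurve of curve P.

(** Almost constancy of all inner and outer integrands is included because additivity of [integ] is
    established only for such functions. *)
Definition Fubini (h : M -> M -> R) : Prop :=
  [/\ forall a, almost_const (h a), forall b, almost_const (h^~ b),
      almost_const (fun a => integ (h a)),
      almost_const (fun b => integ (h^~ b)) &
      integ (fun a => integ (h a)) = integ (fun b => integ (h^~ b))].

Lemma FubiniD h h' : Fubini h -> Fubini h' -> Fubini (fun a b => h a b + h' a b).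
Proof.
move=> [h1 h2 h3 h4 h5] [g1 g2 g3 g4 g5]; split.
- by move=> a; exact: almost_constD.
- by move=> b; exact: almost_constD.
- by under eq_fun do rewrite integD //; exact: almost_constD.
- by under eq_fun do rewrite integD //; exact: almost_constD.
under eq_fun do rewrite integD //; rewrite integD // h5 g5 -integD //.
by under [in RHS]eq_fun do rewrite integD //.
Qed.

Lemma FubiniN h : Fubini h -> Fubini (fun a b => -1 * h a b).
Proof.
move=> [h1 h2 h3 h4 h5]; split.
- by move=> a; exact: almost_constZ.
- by move=> b; exact: almost_constZ.
- by under eq_fun do rewrite integZ //; exact: almost_constZ.
- by under eq_fun do rewrite integZ //; exact: almost_constZ.
under eq_fun do rewrite integZ //; rewrite integZ // h5 -integZ //.
by under [in RHS]eq_fun do rewrite integZ //.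
Qed.

Lemma Fubini_swap h : Fubini h -> Fubini (fun a b => h b a).
Proof. by move=> [h1 h2 h3 h4 h5]; split. Qed.

Lemma flat_swap P : flat P -> flat (fun a b => P b a).
Proof.
case=> [H|H|[p H|p H|k H|k H]].
- exact: FlatAll.
- by apply: FlatSub => a b a' b' h /(H _ _ _ _ h)[-> ->].
- by apply/FlatCurve/(@Hline _ p).
- by apply/FlatCurve/(@Vline _ p).
- by apply/FlatCurve/(@Cograph _ k).
- by apply/FlatCurve/(@Graph _ k).
Qed.

(** The delicate case is a graph of [f^k]: one order integrates the constant [r], the other [r]
    times the indicator of [f^k(M)], and these agree by [integ_range]. Horizontal lines and cographs
    follow by exchanging the coordinates. *)
Lemma Fubini_flat P (r : R) : flat P ->
  Fubini (fun a b => if `[< P a b >] then r else 0).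
Proof.
have L (Q : M -> M -> Prop) p : (forall a b, Q a b <-> a = p) ->
    Fubini (fun a b => if `[< Q a b >] then r else 0).
  move=> H.
  have -> : (fun a b => if `[< Q a b >] then r else 0) =
      (fun a _ => if a == p then r else 0).
    apply: funext => a; apply: funext => b; congr (if _ then _ else _).
    by apply/asboolP/eqP => /H.
  have E : (fun a => integ (fun=> if a == p then r else 0)) =
      (fun a => if a == p then r * X else 0).
    by apply: funext => a; rewrite integ_cst; case: eqP; rewrite ?mul0r.
  split.
  - by move=> a; exact: almost_const_cst.
  - by move=> b; exact: almost_const_point.
  - by rewrite E; exact: almost_const_point.
  - by exact: almost_const_cst.
  - by rewrite E integ_point integ_cst integ_point.
have G (Q : M -> M -> Prop) k : (forall a b, Q a b <-> b = iter k f a) ->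
    Fubini (fun a b => if `[< Q a b >] then r else 0).
  move=> H.
  have -> : (fun a b => if `[< Q a b >] then r else 0) =
      (fun a b => if b == iter k f a then r else 0).
    apply: funext => a; apply: funext => b; congr (if _ then _ else _).
    by apply/asboolP/eqP => /H.
  have E b : almost_const (fun a => if b == iter k f a then r else 0) /\
      integ (fun a => if b == iter k f a then r else 0) =
      if `[< exists y, iter k f y = b >] then r else 0.
    case: asboolP => [[y <-]|ny].
      under eq_fun do rewrite (inj_eq (@iterf_inj k)) eq_sym.
      by split; [exact: almost_const_point|exact: integ_point].
    have -> : (fun a : M => if b == iter k f a then r else 0) = (fun=> 0).
      by apply: funext => a; case: eqP => // e; case: ny; exists a.
    by split; [exact: almost_const_cst|rewrite integ_cst mul0r].
  have [c1 i1] := integ_range k r.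
  split.
  - by move=> a; exact: almost_const_point.
  - by move=> b; exact: (E b).1.
  - by under eq_fun do rewrite integ_point; exact: almost_const_cst.
  - by under eq_fun do rewrite (E _).2.
  - under eq_fun do rewrite integ_point.
    by under [in RHS]eq_fun do rewrite (E _).2; rewrite integ_cst i1.
case=> [H|H|[p H|p H|k H|k H]].
- have -> : (fun a b => if `[< P a b >] then r else 0) = (fun _ _ => r).
    by apply: funext => a; apply: funext => b; rewrite asboolT.
  by split=> // *; exact: almost_const_cst.
- case: (pselect (exists a b, P a b)) => [[p [q pq]]|nP].
    have -> : (fun a b => if `[< P a b >] then r else 0) =
        (fun a b => if a == p then (if b == q then r else 0) else 0).
      apply: funext => a; apply: funext => b; case: asboolP => [ab|nab].
        by have [-> ->] := H _ _ _ _ ab pq; rewrite !eqxx.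
      by case: eqP => // ap; case: eqP => // bq; case: nab; rewrite ap bq.
    have E1 a : almost_const (fun b => if a == p then (if b == q then r else 0) else 0)
        /\ integ (fun b => if a == p then (if b == q then r else 0) else 0) =
      if a == p then r else 0.
      case: eqP => _; last by split; [exact: almost_const_cst|rewrite integ_cst mul0r].
      by split; [exact: almost_const_point|exact: integ_point].
    have E2 b : almost_const (fun a => if a == p then (if b == q then r else 0) else 0)
        /\ integ (fun a => if a == p then (if b == q then r else 0) else 0) =
      if b == q then r else 0.
      by split; [exact: almost_const_point|exact: integ_point].
    split.
    + by move=> a; exact: (E1 a).1.
    + by move=> b; exact: (E2 b).1.
    + by under eq_fun do rewrite (E1 _).2; exact: almost_const_point.
    + by under eq_fun do rewrite (E2 _).2; exact: almost_const_point.
    + under eq_fun do rewrite (E1 _).2.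
      by under [in RHS]eq_fun do rewrite (E2 _).2; rewrite !integ_point.
  have -> : (fun a b => if `[< P a b >] then r else 0) = (fun _ _ => 0).
    apply: funext => a; apply: funext => b; rewrite asboolF // => ab.
    by apply: nP; exists a, b.
  by split=> // *; exact: almost_const_cst.
- exact: L H.
- exact/Fubini_swap/(L (fun a b => P b a) p).
- exact: G H.
- exact/Fubini_swap/(G (fun a b => P b a) k).
Qed.

Lemma flat_ext (P Q : M -> M -> Prop) :
  (forall a b, P a b <-> Q a b) -> flat P -> flat Q.
Proof.
by move=> H; suff -> : P = Q by []; apply: funext => a; apply: funext => b;
  exact/propext.
Qed.

Lemma flat_empty (P : M -> M -> Prop) : (forall a b, ~ P a b) -> flat P.
Proof. by move=> H; apply: FlatSub => a b a' b' /H. Qed.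

Lemma curveI P Q : curve P -> curve Q -> flat (fun a b => P a b /\ Q a b).
Proof.
move=> cP cQ; case: (cP) (cQ) => [p H|p H|k H|k H] [q K|q K|l K|l K].
- case: (pselect (p = q)) => [pq|pq].
    by apply: flat_ext (FlatCurve cP) => a b; rewrite K H pq; split=> [|[]].
  by apply: flat_empty => a b [/H -> /K].
- by apply: FlatSub => a b a' b' [/H -> /K ->] [/H -> /K ->].
- by apply: FlatSub => a b a' b' [/H -> /K ->] [/H -> /K ->].
- by apply: FlatSub => a b a' b' [/H -> /K e] [/H -> /K]; rewrite e => /iterf_inj.
- by apply: FlatSub => a b a' b' [/H -> /K ->] [/H -> /K ->].
- case: (pselect (p = q)) => [pq|pq].
    by apply: flat_ext (FlatCurve cP) => a b; rewrite K H pq; split=> [|[]].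
  by apply: flat_empty => a b [/H -> /K].
- by apply: FlatSub => a b a' b' [/H -> /K e] [/H -> /K]; rewrite e => /iterf_inj.
- by apply: FlatSub => a b a' b' [/H -> /K ->] [/H -> /K ->].
- by apply: FlatSub => a b a' b' [/H + /K e] [/H + /K e']; rewrite e e' => -> ->.
- by apply: FlatSub => a b a' b' [/H + /K e] [/H + /K e']; rewrite e e' => ->
    /iterf_inj.
- case: (pselect (k = l)) => [kl|kl].
    by apply: flat_ext (FlatCurve cP) => a b; rewrite K H kl; split=> [|[]].
  by apply: flat_empty => a b [/H -> /K /iterf_eq].
(* A common point of a graph and a cograph gives a fixed point of [f^(l+k)]. Hence either both
   exponents vanish and both curves are the diagonal, or the intersection is empty. *)
- case: (posnP (l + k)) => [/eqP|lk].
    rewrite addn_eq0 => /andP[/eqP l0 /eqP k0].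
    apply: flat_ext (FlatCurve cP) => a b; rewrite K H k0 l0 /=.
    by split=> [|[]].
  apply: flat_empty => a b [/H -> /K]; rewrite -iterD => /esym.
  exact: f_acyclic.
- by apply: FlatSub => a b a' b' [/H + /K e] [/H + /K e']; rewrite e e' => ->
    /iterf_inj.
- by apply: FlatSub => a b a' b' [/H + /K e] [/H + /K e']; rewrite e e' => -> ->.
- case: (posnP (l + k)) => [/eqP|lk].
    rewrite addn_eq0 => /andP[/eqP l0 /eqP k0].
    apply: flat_ext (FlatCurve cP) => a b; rewrite K H k0 l0 /=.
    by split=> [|[]].
  apply: flat_empty => a b [/H -> /K]; rewrite -iterD => /esym.
  exact: f_acyclic.
- case: (pselect (k = l)) => [kl|kl].
    by apply: flat_ext (FlatCurve cP) => a b; rewrite K H kl; split=> [|[]].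
  by apply: flat_empty => a b [/H -> /K /iterf_eq].
Qed.

Lemma flatI P Q : flat P -> flat Q -> flat (fun a b => P a b /\ Q a b).
Proof.
case=> [H|H|cP] [K|K|cQ].
- by apply: FlatAll.
- by apply: FlatSub => a b a' b' [_ h] [_ h']; exact: K.
- by apply: flat_ext (FlatCurve cQ) => a b; split=> [|[]].
- by apply: FlatSub => a b a' b' [h _] [h' _]; exact: H.
- by apply: FlatSub => a b a' b' [h _] [h' _]; exact: H.
- by apply: FlatSub => a b a' b' [h _] [h' _]; exact: H.
- by apply: flat_ext (FlatCurve cP) => a b; split=> [|[]].
- by apply: FlatSub => a b a' b' [_ h] [_ h']; exact: K.
- exact: curveI.
Qed.

(** On the plane of the coordinates [u] and [v], each side of the atom is an iterate of [a], of [b]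
    or of a constant. Cancelling the smaller power of [f] turns an equation between [a] and [b] into
    a graph or a cograph. *)
Lemma flat_atom V (x : V -> M) u v k l (s t : V + M) : u <> v ->
  flat (fun a b => atom k l s t (upd (upd x u a) v b)).
Proof.
move=> uv; pose z a b := upd (upd x u a) v b.
have kind (w : V + M) : [\/ forall a b, val (z a b) w = a,
    forall a b, val (z a b) w = b | exists p, forall a b, val (z a b) w = p].
  case: w => [w|p]; last by apply: Or33; exists p.
  case: (pselect (w = v)) => [->|wv].
    by apply: Or32 => a b; rewrite /= /z upd_same.
  case: (pselect (w = u)) => [->|wu].
    by apply: Or31 => a b; rewrite /= /z upd_other // upd_same.
  by apply: Or33; exists (x w) => a b; rewrite /= /z !upd_other.
have same i j : flat (fun a _ => iter i f a = iter j f a).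
  case: (pselect (i = j)) => [->|ij]; first exact: FlatAll.
  by apply: flat_empty => a _ /iterf_eq.
have diff i j : flat (fun a b => iter i f a = iter j f b).
  apply: FlatCurve; case: (leqP i j) => ij.
    apply: (@Cograph _ (j - i)) => a b; rewrite -{1}(subnKC ij) iterD.
    by split=> [/iterf_inj|->].
  apply: (@Graph _ (i - j)) => a b; rewrite -{1}(subnKC (ltnW ij)) iterD.
  by split=> [/iterf_inj|->].
have cst i p : flat (fun a _ => iter i f a = p).
  case: (pselect (exists m, iter i f m = p)) => [[m <-]|nm].
    by apply/FlatCurve/(@Vline _ m) => a _; split=> [/iterf_inj|->].
  by apply: flat_empty => a _ e; apply: nm; exists a.
suff : flat (fun a b => iter k f (val (z a b) s) = iter l f (val (z a b) t)).
  by apply: flat_ext => a b; split=> /asboolP.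
case: (kind s) (kind t) => [H|H|[p H]] [K|K|[q K]].
- by apply: flat_ext (same k l) => a b; rewrite H K.
- by apply: flat_ext (diff k l) => a b; rewrite H K.
- by apply: flat_ext (cst k (iter l f q)) => a b; rewrite H K.
- by apply: flat_ext (diff l k) => a b; rewrite H K; split.
- by apply: flat_ext (flat_swap (same k l)) => a b; rewrite H K.
- by apply: flat_ext (flat_swap (cst k (iter l f q))) => a b; rewrite H K.
- by apply: flat_ext (cst l (iter k f p)) => a b; rewrite H K; split.
- by apply: flat_ext (flat_swap (cst l (iter k f p))) => a b; rewrite H K; split.
- case: (pselect (iter k f p = iter l f q)) => e.
    by apply: FlatAll => a b; rewrite H K.
  by apply: flat_empty => a b; rewrite H K.
Qed.

(** The induction carries a flat condition [P] and avoids negated atoms, which need not be flat: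
    with [Q] the conjunction of [P] and the atom, the integrand is [F] on [Q], plus [G] on [P],
    minus [G] on [Q]. *)
Lemma Fubini_simple V (F : (V -> M) -> R) x u v P : u <> v -> simple F ->
  flat P -> Fubini (fun a b => if `[< P a b >] then F (upd (upd x u a) v b) else 0).
Proof.
move=> uv sF; elim: sF P => [r|k l s t {}F G _ IF _ IG] P fP.
  exact: Fubini_flat.
pose Q a b := P a b /\ atom k l s t (upd (upd x u a) v b).
have fQ : flat Q by apply: flatI => //; exact: flat_atom.
have := FubiniD (IF _ fQ) (FubiniD (IG _ fP) (FubiniN (IG _ fQ))).
congr Fubini; apply: funext => a; apply: funext => b; rewrite /Q.
case: (atom k l s t _); case: (asboolP (P a b)) => Pab.
- by rewrite asboolT //= mulN1r subrr addr0.
- by rewrite asboolF ?mulr0 ?addr0 // => -[].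
- by rewrite asboolF ?mulr0 ?addr0 ?add0r // => -[].
- by rewrite asboolF ?mulr0 ?addr0 ?add0r // => -[].
Qed.

(** * Iterated integrals *)

Definition integ_var V (v : V) (F : (V -> M) -> R) : (V -> M) -> R :=
  fun x => integ (fun m => F (upd x v m)).

(** The result stays a function on all of [M^V], independent of the coordinates in [r]; no
    integration changes the type of variables. *)
Definition Int V (r : seq V) (F : (V -> M) -> R) : (V -> M) -> R :=
  foldr (@integ_var V) F r.

Lemma simple_Int V (r : seq V) F : simple F -> simple (Int r F).
Proof. by elim: r => //= v r IH /IH/(simple_fiber v)[]. Qed.

Lemma almost_const_Int V (r : seq V) F x v : simple F ->
  almost_const (fun m => Int r F (upd x v m)).
Proof. by move=> /(simple_Int r)/(simple_fiber v)[]. Qed.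

Lemma upd_swap V (x : V -> M) u v a b : u <> v ->
  upd (upd x u a) v b = upd (upd x v b) u a.
Proof.
move=> uv; apply: funext => w; rewrite /upd.
by case: (asboolP (w = v)) => // ->; rewrite asboolF // => /esym.
Qed.

Lemma integ_varC V (u v : V) F : simple F ->
  integ_var u (integ_var v F) = integ_var v (integ_var u F).
Proof.
case: (pselect (u = v)) => [-> //|uv sF]; apply: funext => x.
have fT : flat (fun _ _ : M => True) by apply: FlatAll.
have [_ _ _ _] := Fubini_simple x uv sF fT.
rewrite /integ_var asboolT // => ->; congr integ; apply: funext => b.
by congr integ; apply: funext => a; rewrite upd_swap.
Qed.

Lemma Int_perm (V : eqType) (r r' : seq V) F : simple F ->
  perm_eq r r' -> Int r F = Int r' F.
Proof.
move=> sF.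
have remE (s : seq V) v : v \in s -> Int s F = integ_var v (Int (rem v s) F).
  elim: s => //= w s IH; rewrite inE; case: eqVneq => [-> //|vw /IH -> /=].
  by rewrite integ_varC //; exact: simple_Int.
elim: r r' => [|v r IH] r' rr'.
  by move/perm_size: rr' => /esym/size0nil ->.
have vr' : v \in r' by rewrite -(perm_mem rr') mem_head.
rewrite (remE r' v) //=; congr integ_var; apply: IH.
by rewrite -(perm_cons v); apply: perm_trans rr' _; exact: perm_to_rem.
Qed.

Lemma Int_cat V (r s : seq V) F : Int (r ++ s) F = Int r (Int s F).
Proof. by rewrite /Int foldr_cat. Qed.

Lemma IntD V (r : seq V) F G : simple F -> simple G ->
  Int r (fun x => F x + G x) = (fun x => Int r F x + Int r G x).
Proof.
move=> sF sG; elim: r => //= v r ->; apply: funext => x.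
by rewrite /integ_var integD //; exact: almost_const_Int.
Qed.

Lemma IntZ (V : eqType) (r : seq V) (a : (V -> M) -> R) F : simple F ->
  (forall x v m, v \in r -> a (upd x v m) = a x) ->
  Int r (fun x => a x * F x) = (fun x => a x * Int r F x).
Proof.
move=> sF; elim: r => //= v r IH ar; rewrite IH => [|x w m wr]; last first.
  by rewrite ar // inE wr orbT.
apply: funext => x; rewrite /integ_var -integZ; last exact: almost_const_Int.
by congr integ; apply: funext => m; rewrite ar ?mem_head.
Qed.

Lemma Int_map V W (g : V -> W) (r : seq V) F z : injective g ->
  Int (map g r) (fun x => F (x \o g)) z = Int r F (z \o g).
Proof.
move=> gi; elim: r z => //= v r IH z; rewrite /integ_var; congr integ.
apply: funext => m; rewrite IH; congr Int; apply: funext => w /=.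
by rewrite /upd; congr (if _ then _ else _); apply: asbool_equiv_eq; split=> [/gi|->].
Qed.

Definition agree (V : eqType) (r : seq V) (x z : V -> M) : Prop :=
  forall v, v \notin r -> x v = z v.

Lemma Int_agree (V : eqType) (r : seq V) F x z :
  agree r x z -> Int r F x = Int r F z.
Proof.
elim: r x z => [|v r IH] x z xz /=.
  by congr F; apply: funext => v; exact: xz.
rewrite /integ_var; congr integ; apply: funext => m; apply: IH => w wr.
rewrite /upd; case: asboolP => // wv; apply: xz.
by rewrite inE (negbTE wr) orbF; apply/eqP.
Qed.

(** The inner integrals vanish unless the coordinate [v] equals [p v], where they equal [a]; as a
    point has mass [1], the outer integral is [a]. *)
Lemma Int_point (V : eqType) (r : seq V) F (p z : V -> M) (a : R) : uniq r ->
  (forall x, agree r x z ->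
    F x = if `[< forall v, v \in r -> x v = p v >] then a else 0) ->
  Int r F z = a.
Proof.
elim: r F z a => [|v r IH] F z a /=; first by move=> _ /(_ z) ->; rewrite ?asboolT.
move=> /andP[vr ur] FE; rewrite /integ_var -(integ_point (p v) a).
congr integ; apply: funext => m; apply: IH => // x xz.
have xv : x v = m by rewrite xz // upd_same.
rewrite FE => [|w]; last first.
  rewrite inE => /norP[/eqP wv wr]; rewrite xz // upd_other //.
case: eqP => [mp|mp]; last first.
  rewrite asboolF => [|/(_ v)]; first by case: ifP.
  by rewrite mem_head xv => /(_ isT).
congr (if _ then _ else _); apply: asbool_equiv_eq; split=> H w wr.
  by apply: H; rewrite inE wr orbT.
by move: wr; rewrite inE => /orP[/eqP ->|/H //]; rewrite xv.
Qed.

Definition indic V (A : set (V -> M)) (x : V -> M) : R := `[< A x >]%:R.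

Lemma simple_indic V (A : set (V -> M)) : definable A -> simple (indic A).
Proof.
by move=> /simple_definable; exact: (simple_comp (fun b : bool => b%:R : R)).
Qed.

(** A set with at most one point has mass [1] or [0] according to whether it is inhabited. The
    fibres of the graph of a bijection are of this kind. *)
Lemma Int_unique (V : eqType) (r : seq V) (P : set (V -> M)) z (Q : Prop) :
  uniq r ->
  (forall x y, agree r x z -> agree r y z -> P x -> P y -> x = y) ->
  (Q <-> exists2 x, agree r x z & P x) ->
  Int r (indic P) z = `[< Q >]%:R.
Proof.
move=> ur Pu QP; case: (pselect Q) => [q|nq].
  have [p pz Pp] := QP.1 q.
  apply: (@Int_point _ _ _ p) => // x xz; rewrite /indic (asboolT q).
  case: asboolP => [Px|nP]; first by rewrite asboolT // (Pu x p).
  rewrite asboolF // => xp; apply: nP; suff -> : x = p by [].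
  apply: funext => v; case: (boolP (v \in r)) => [/xp //|vr].
  by rewrite xz // pz.
apply: (@Int_point _ _ _ z) => // x xz.
rewrite /indic (asboolF nq) asboolF; first by case: ifP.
by move=> Px; apply: nq; apply/QP; exists x.
Qed.

(** * The Euler characteristic *)

Variable m0 : M.

Definition chi (V : finType) (A : set (V -> M)) : R :=
  Int (enum V) (indic A) (fun=> m0).

Lemma chiE (V : finType) (A : set (V -> M)) z : Int (enum V) (indic A) z = chi A.
Proof. by apply: Int_agree => v; rewrite mem_enum. Qed.

Lemma chi_bij (V W : finType) (A : set (V -> M)) (B : set (W -> M)) :
  definable_bij A B -> chi A = chi B.
Proof.
move=> /definable_bijP[r [dr rAB rA rB rinj]].
set G := [set z : V + W -> M | _] in dr.
have sG := simple_indic dr.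
have inlI : injective (@inl V W) by move=> ? ? [].
have inrI : injective (@inr V W) by move=> ? ? [].
pose s1 : seq (V + W)%type := map inl (enum V).
pose s2 : seq (V + W)%type := map inr (enum W).
have u1 : uniq s1 by rewrite map_inj_uniq ?enum_uniq.
have u2 : uniq s2 by rewrite map_inj_uniq ?enum_uniq.
have n1 w : inr w \notin s1 by apply/mapP => -[].
have n2 v : inl v \notin s2 by apply/mapP => -[].
have i1 v : inl v \in s1 by rewrite map_f ?mem_enum.
have i2 w : inr w \in s2 by rewrite map_f ?mem_enum.
pose z0 : V + W -> M := fun=> m0.
(* For fixed [V]-coordinates the graph has one point if they lie in [A] and none otherwise, so
   integrating out [W] leaves the indicator of [A]. *)
have E2 z : Int s2 (indic G) z = indic A (z \o inl).
  have e x : agree s2 x z -> x \o inl = z \o inl.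
    by move=> xz; apply: funext => v; exact: xz.
  apply: Int_unique => //.
    move=> x y xz yz Gx Gy; rewrite -(scons_comp x) -(scons_comp y) (e x) // (e y) //.
    congr scons; apply/(rinj _ _ _ _ Gx Gy); by rewrite e // e.
  split=> [/rA[y ry]|[x /e <- /rAB[]//]].
  by exists (scons (z \o inl) y) => // -[v|w] //; rewrite i2.
have E1 z : Int s1 (indic G) z = indic B (z \o inr).
  have e x : agree s1 x z -> x \o inr = z \o inr.
    by move=> xz; apply: funext => v; exact: xz.
  apply: Int_unique => //.
    move=> x y xz yz Gx Gy; rewrite -(scons_comp x) -(scons_comp y) (e x) // (e y) //.
    congr scons; apply/(rinj _ _ _ _ Gx Gy); by rewrite e // e.
  split=> [/rB[y ry]|[x /e <- /rAB[]//]].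
  by exists (scons y (z \o inr)) => // -[v|w] //; rewrite i1.
have -> : chi A = Int (s1 ++ s2) (indic G) z0.
  by rewrite Int_cat (funext E2) Int_map.
have -> : chi B = Int (s2 ++ s1) (indic G) z0.
  by rewrite Int_cat (funext E1) Int_map.
by congr (_ z0); apply: Int_perm => //; rewrite perm_catC.
Qed.

Lemma chiU (V : finType) (A B : set (V -> M)) : definable A -> definable B ->
  A `&` B = set0 -> chi (A `|` B) = chi A + chi B.
Proof.
move=> dA dB AB; have E x : indic (A `|` B) x = indic A x + indic B x.
  rewrite /indic asbool_or.
  case: (asboolP (A x)) => a; case: (asboolP (B x)) => b; rewrite ?addr0 ?add0r //.
  by have : set0 x by rewrite -AB.
rewrite /chi (funext E) IntD //; exact: simple_indic.
Qed.

Lemma chiX m n (A : set ('I_m -> M)) (B : set ('I_n -> M)) :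
  definable A -> definable B -> chi (prod_set A B) = chi A * chi B.
Proof.
move=> dA dB; set z0 : 'I_(m + n) -> M := fun=> m0.
pose s1 : seq 'I_(m + n) := map (lshift n) (enum 'I_m).
pose s2 : seq 'I_(m + n) := map (@rshift m n) (enum 'I_n).
have li : injective (@lshift m n) by exact: lshift_inj.
have ri : injective (@rshift m n) by exact: rshift_inj.
(* Variables may be integrated in any order, so it suffices that the two blocks together enumerate
   the coordinates up to permutation. *)
have perm : perm_eq (enum 'I_(m + n)) (s1 ++ s2).
  apply: uniq_perm; first exact: enum_uniq.
    rewrite cat_uniq (map_inj_uniq li) (map_inj_uniq ri) !enum_uniq andbT /=.
    apply/hasPn => i /mapP[j _ ->]; apply/mapP => -[k _ /eqP].
    by rewrite eq_rlshift.
  move=> i; rewrite mem_enum mem_cat; apply/esym.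
  by case: (split_ordP i) => j ->; rewrite map_f ?mem_enum ?orbT.
have sP := simple_indic (definable_prod dA dB).
rewrite /chi (Int_perm sP perm) Int_cat -/z0.
have sB : simple (fun z : 'I_(m + n) -> M => indic B (z \o @rshift m n)).
  by apply: simple_indic; exact: definable_subl.
have sA : simple (fun z : 'I_(m + n) -> M => indic A (z \o lshift n)).
  by apply: simple_indic; exact: definable_subl.
have E z : indic (prod_set A B) z =
    indic A (z \o lshift n) * indic B (z \o @rshift m n).
  by rewrite /indic asbool_and -natrM mulnb.
rewrite (funext E) IntZ // => [|x v a /mapP[j _ ->]]; last first.
  congr indic; apply: funext => i /=; apply: upd_other => /eqP.
  by rewrite eq_lrshift.
have E' z : indic A (z \o lshift n) *
      Int s2 (fun z => indic B (z \o @rshift m n)) z =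
    chi B * indic A (z \o lshift n).
  by rewrite Int_map // chiE mulrC.
by rewrite (funext E') (@IntZ _ _ (fun=> chi B)) // Int_map // mulrC chiE.
Qed.

Lemma chi_power0 : chi [set: 'I_0 -> M] = 1.
Proof.
rewrite /chi (_ : enum 'I_0 = [::]); last by apply: size0nil; rewrite size_enum_ord.
by rewrite /= /indic asboolT.
Qed.

Lemma chi_power1 : chi [set: 'I_1 -> M] = X.
Proof.
rewrite /chi (_ : enum 'I_1 = [:: ord0]); last first.
  by rewrite (enum_ordSl 0) /= (_ : enum 'I_0 = [::]) //; apply: size0nil;
    rewrite size_enum_ord.
rewrite /= /integ_var (_ : (fun=> _) = (fun=> 1)) ?integ_cst ?mul1r //.
by apply: funext => m; rewrite /indic asboolT.
Qed.

End Integral.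

(** * Generation of the Grothendieck ring by [[M]] *)

Section PolynomialClasses.
Variables (hM : nontrivial M) (m0 : M).
Hypothesis N_gt0 : (0 < N)%N.
Local Notation K := (K0 hM).
Local Notation kc A := (kclass hM A).

Lemma definable_coord (p : M) : definable [set x : 'I_1 -> M | x ord0 = p].
Proof. exact: (@definable_eq _ _ 'I_1 (inl ord0) (inr p)). Qed.

Lemma kclass_point p : kc [set x : 'I_1 -> M | x ord0 = p] = 1.
Proof.
rewrite -(kclass_power0 hM); apply: kclass_bij; first exact: definable_coord.
  exact: definableT.
apply: (@definable_bij_coord _ _ _ _ _ _ (I0_elim _)); first exact: definable_coord.
split=> // [x y|y _].
  rewrite !inE /= => xp yp _; apply: funext => i.
  by rewrite (ord1 i) xp yp.
by exists (fun=> p) => //; apply: funext => -[].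
Qed.

Lemma kclass_natN : N%:R = 0 :> K.
Proof.
pose S (r : seq 'I_N) := [set x : 'I_1 -> M | exists2 i, i \in r & x ord0 = c i].
have SP r : uniq r -> definable (S r) /\ kc (S r) = (size r)%:R.
  elim: r => [_|i r IH /= /andP[ir /IH[dr kr]]].
    have -> : S [::] = set0 by apply/seteqP; split=> // x [].
    by rewrite kclass0; split=> //; exact: definable0.
  have -> : S (i :: r) = [set x | x ord0 = c i] `|` S r.
    apply/seteqP; split=> x.
      by move=> [j]; rewrite inE => /orP[/eqP ->|jr] e; [left|right; exists j].
    move=> [e|[j jr e]]; first by exists i; rewrite ?mem_head.
    by exists j; rewrite // inE jr orbT.
  have di := definable_coord (c i).
  split; first exact: definableU.
  rewrite kclassU // ?kclass_point ?kr -?natr1 1?addrC //.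
  apply/seteqP; split=> // x [/= e [j jr]]; rewrite e => /c_inj ij.
  by rewrite ij jr in ir.
have [dS kS] := SP (enum 'I_N) (enum_uniq _).
have [cR _ cS] := c_bij.
have dC := definableC dS; have dT := definableT M 'I_1.
(* [f] itself is the definable bijection from [M] onto the complement of the points [c i]. *)
have e1 : kc [set: 'I_1 -> M] = kc (~` S (enum 'I_N)).
  apply: kclass_bij => //.
  exists (fun x _ => f (x ord0)); split; first split.
  - move=> x _ [i _]; move=> e; apply: (cR i I); by exists (x ord0).
  - move=> x y _ _ /(congr1 (fun g => g ord0)) /f_inj e.
    by apply: funext => i; rewrite (ord1 i).
  - move=> y ny; case: (pselect (range f (y ord0))) => [[z _ zy]|/cS[i _ iy]].
      by exists (fun=> z) => //; apply: funext => i; rewrite (ord1 i).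
    by case: ny; exists i; rewrite ?mem_enum.
  congr definable: (@definable_atom M ('I_1 + 'I_1)%type 0 1
    (inl (inr ord0)) (inl (inl ord0))).
  apply/seteqP; split=> z /=.
    by move=> /asboolP /= e; split=> //; apply: funext => i; rewrite (ord1 i).
  by move=> [_ /(congr1 (fun g => g ord0)) e]; apply/asboolP.
have := kclass_split hM dT dS; rewrite !setTI -e1 kS size_enum_ord => e.
by apply: (addIr (kc [set: 'I_1 -> M])); rewrite add0r -e.
Qed.

Definition KX : K := kc [set: 'I_1 -> M].

(** Nonnegative coefficients suffice since [N%:R = 0] in [K]. *)
Inductive is_polynomial : K -> Prop :=
| PolyZero : is_polynomial 0
| PolyStep (a : nat) z : is_polynomial z -> is_polynomial (a%:R + KX * z).

Lemma is_polynomialD y z : is_polynomial y -> is_polynomial z ->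
  is_polynomial (y + z).
Proof.
move=> py; elim: py z => [z|a {}y py IH z pz]; first by rewrite add0r.
case: pz => [|b {}z pz]; first by rewrite addr0; exact: PolyStep.
by rewrite addrACA -natrD -mulrDr; apply: PolyStep; exact: IH.
Qed.

(** Since [N] kills the ring and is positive, [- z] is the sum of [N - 1] copies of [z]. *)
Lemma is_polynomialN z : is_polynomial z -> is_polynomial (- z).
Proof.
have -> : - z = z *+ N.-1.
  apply/eqP; rewrite eq_sym -addr_eq0 -mulrSr prednK //.
  by rewrite -mulr_natr kclass_natN mulr0.
by elim: N.-1 => [|k IH] pz; [exact: PolyZero|rewrite mulrS; apply: is_polynomialD; auto].
Qed.

Lemma is_polynomialX z : is_polynomial z -> is_polynomial (z * KX).
Proof. by move=> /(PolyStep 0); rewrite add0r mulrC. Qed.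

(** When an atom [a] determines the last coordinate, replacing [F] by [G] on [a]
    only changes the set by graphs over subsets of [M^n]. *)
Lemma kclass_cell n (b : ('I_(n + 1) -> M) -> bool) (Q : set ('I_n -> M)) :
  (forall A : set ('I_n -> M), definable A -> is_polynomial (kc A)) ->
  simple b -> definable Q ->
  is_polynomial (kc [set z : 'I_(n + 1) -> M | Q (z \o lshift 1) /\ b z]).
Proof.
move=> IHn sb; elim: sb Q => [a|k l s t F G sF IF sG IG] Q dQ.
  case: a.
    have -> : [set z : 'I_(n + 1) -> M | Q (z \o lshift 1) /\ true] = prod_set Q setT.
      by apply/seteqP; split=> z [].
    by rewrite kclassX //; [apply/is_polynomialX/IHn|exact: definableT].
  have -> : [set z : 'I_(n + 1) -> M | Q (z \o lshift 1) /\ false] = set0.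
    by apply/seteqP; split=> z [].
  by rewrite kclass0; exact: PolyZero.
pose v : 'I_(n + 1) := rshift n ord0.
case: (atom_cases k l s t v) => [H|[k1 [l1 [t1 [t1v H]]]]].
  (* The atom is here a condition on the first [n] coordinates alone, read off by setting the last
     one to [m0]; the base [Q] is cut along it. *)
  pose Qa := [set x : 'I_n -> M | atom k l s t (joinI x (fun _ : 'I_1 => m0))].
  have dQa : definable Qa.
    have := definable_sub (fun i : 'I_(n + 1) => match fintype.split i with
      inl j => inl j | inr _ => inr m0 end) (definable_atom k l s t).
    congr definable; apply/seteqP; split=> x /=; rewrite /Qa /=;
      congr (is_true (atom _ _ _ _ _)); apply: funext => i; rewrite /joinI;
      by case: fintype.split.
  have aE z : atom k l s t z <-> Qa (z \o lshift 1).
    rewrite /Qa /= -(H z m0); suff -> : upd z v m0 = joinI (z \o lshift 1) (fun=> m0).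
      by [].
    apply/joinIP; rewrite joinIl joinIr; split; apply: funext => i /=.
      by rewrite upd_other // => /eqP; rewrite eq_lrshift.
    by rewrite (ord1 i) upd_same.
  have d1 : definable [set z : 'I_(n + 1) -> M | Qa (z \o lshift 1)].
    exact: definable_subl.
  have d2 := definable_simple (simple_if k l s t sF sG).
  have d3 : definable [set z : 'I_(n + 1) -> M | Q (z \o lshift 1)].
    exact: definable_subl.
  rewrite (kclass_split hM (definableI d3 d2) d1); apply: is_polynomialD.
    have := IF (Q `&` Qa) (definableI dQ dQa); congr (is_polynomial (kc _)).
    apply/seteqP; split=> z /=.
      by move=> [[q qa] Fz]; split=> //; split=> //; rewrite (introT idP ((aE z).2 qa)).
    move=> [[q Fz] qa]; split=> //.
    by move: Fz; rewrite ((aE z).2 qa).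
  have := IG (Q `&` ~` Qa) (definableI dQ (definableC dQa)).
  congr (is_polynomial (kc _)).
  have nE z : ~ Qa (z \o lshift 1) -> atom k l s t z = false.
    by move=> nq; apply/negP => /aE.
  apply/seteqP; split=> z /=.
    by move=> [[q qa] Fz]; split=> //; split=> //; rewrite nE.
  by move=> [[q Fz] qa]; split=> //; move: Fz; rewrite nE.
(* Inside the atom the last coordinate is determined by the others, because [f^k1] is injective.
   Hence [C] is in definable bijection with its projection to [M^n], where [IHn] applies. *)
have graph (C : set ('I_(n + 1) -> M)) : definable C ->
    (forall z, C z -> atom k l s t z) -> is_polynomial (kc C).
  move=> dC Ca; pose D := [set x | exists y : 'I_1 -> M, C (joinI x y)].
  have dD : definable D.
    have := definable_ex (definable_subl (@fintype.split n 1) dC).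
    by congr definable; apply/seteqP; split=> x /= -[y Cy]; exists y.
  rewrite (@kclass_bij _ _ hM _ _ C D dC dD); first exact: IHn.
  apply: (@definable_bij_coord _ _ _ _ _ _ (fun i => inl (lshift 1 i))) => //.
  split=> [z Cz|z z'|x [y Cxy]].
  - by exists (z \o @rshift n 1); rewrite joinI_eta.
  - rewrite !inE => /Ca + /Ca + e; rewrite !H => /asboolP /= h /asboolP /= h'.
    have vt : val z t1 = val z' t1.
      case: t1 t1v {H h h'} => //= i; case: (split_ordP i) => j -> jv.
        exact: (congr1 (fun g => g j) e).
      by case: jv; rewrite (ord1 j).
    apply/joinIP; split; first exact: e.
    apply: funext => i; rewrite (ord1 i) /=; apply: (@iterf_inj k1).
    by rewrite -/v h h' vt.
  - by exists (joinI x y) => //; exact: joinIl.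
have dA := definable_atom k l s t.
have dF := definable_simple sF; have dG := definable_simple sG.
have d3 : definable [set z : 'I_(n + 1) -> M | Q (z \o lshift 1)].
  exact: definable_subl.
have d2 := definable_simple (simple_if k l s t sF sG).
rewrite (kclass_split hM (definableI d3 d2) dA).
apply: is_polynomialD.
  apply: graph => [|z [] //].
  by apply: definableI => //; exact: definableI.
(* Outside the atom the tree equals [G], so the remaining class is that of [QG] minus that of its
   part inside the atom, again a graph. *)
pose QG := [set z : 'I_(n + 1) -> M | Q (z \o lshift 1)] `&` [set z | G z].
have := IG _ dQ; rewrite -[X in kc X]/QG.
rewrite (kclass_split hM (definableI d3 dG) dA) => /is_polynomialD p.
have /is_polynomialN/p : is_polynomial (kc (QG `&` [set z | atom k l s t z])).
  by apply: graph => [|z [] //]; apply: definableI => //; exact: definableI.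
rewrite addrAC subrr add0r; congr (is_polynomial (kc _)).
apply/seteqP; split=> z /=.
  by move=> [[q g] /negP na]; split; [split=> //; rewrite (negbTE na)|exact/negP].
by move=> [[q g] /negP na]; split; [split=> //; move: g; rewrite (negbTE na)|exact/negP].
Qed.

Lemma kclass_polynomial n (A : set ('I_n -> M)) :
  definable A -> is_polynomial (kc A).
Proof.
have one : is_polynomial 1.
  by rewrite -[1]addr0 -[X in _ + X](mulr0 KX); exact: (PolyStep 1 PolyZero).
elim: n A => [|n IH].
  move=> A dA; case: (pselect (exists x, A x)) => [[x Ax]|nA].
    have -> : A = setT.
      apply/seteqP; split=> // y _; suff -> : y = x by [].
      by apply: funext => -[].
    by rewrite kclass_power0.
  have -> : A = set0 by apply/seteqP; split=> // x Ax; apply: nA; exists x.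
  by rewrite kclass0; exact: PolyZero.
rewrite -addn1 => A dA.
have := kclass_cell IH (simple_definable dA) (definableT M 'I_n).
congr (is_polynomial (kc _)); apply/seteqP; split=> z /=.
  by move=> [_ /asboolP].
by move=> Az; split=> //; exact/asboolP.
Qed.

Lemma K0_polynomial (z : K) : is_polynomial z.
Proof.
have [x [y ->]] := grothP z.
have P (u : Deftilde hM) : is_polynomial (to_groth u).
  elim/Deftilde_ind: u => A; rewrite -/(K0_class hM A) -kclassE.
  exact/kclass_polynomial/dsetP.
by apply: is_polynomialD => //; exact: is_polynomialN.
Qed.

Lemma Euler_morphism (R : comPzRingType) (X : R) : N%:R = 0 :> R ->
  exists phi : {rmorphism K -> R}, phi KX = X.
Proof.
move=> N0; pose ch n (A : set ('I_n -> M)) : R := chi X m0 A.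
pose h (x : Deftilde hM) : R := ch _ (dset (repr x)).
have hE A : h (dclass hM A) = ch _ (dset A).
  exact/(chi_bij X N0 m0)/repr_bij.
have hD : {morph h : x y / x + y}.
  elim/Deftilde_ind => A; elim/Deftilde_ind => B.
  rewrite -[_ + _]/(Deftilde_add _ _) dclassD !hE.
  rewrite /ch /= chiU; last exact: copy_disj (svalP (cid (svalP (cid hM)))).
  - by congr (_ + _); apply: chi_bij => //; [apply: left_copy_bij|apply: right_copy_bij];
      exact: dsetP.
  - exact/definable_left_copy/dsetP.
  - exact/definable_right_copy/dsetP.
have hMul : {morph h : x y / x * y}.
  elim/Deftilde_ind => A; elim/Deftilde_ind => B.
  rewrite -[_ * _]/(Deftilde_mul _ _) dclassM !hE.
  by apply: chiX => //; exact: dsetP.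
have h1 : h 1 = 1 by rewrite hE; exact: chi_power0.
have [phi phiE] := groth_extend h1 hD hMul; exists phi.
by rewrite /KX (kclassE hM (dpower M 1)) phiE hE; exact: chi_power1.
Qed.

(** Every element of [K] is a polynomial in [KX]. If its image vanishes, the constant coefficient is
    divisible by [N], hence zero in [K], and the remaining factor is again in the kernel, so
    induction applies. *)
Lemma Euler_morphism_inj (R : comPzRingType) (phi : {rmorphism K -> R}) :
  (forall (a : nat) r, a%:R + phi KX * r = 0 -> (N %| a)%N /\ r = 0) ->
  injective phi.
Proof.
move=> H; suff inj0 z : phi z = 0 -> z = 0.
  by move=> x y e; apply/subr0_eq/inj0; rewrite rmorphB e subrr.
elim: (K0_polynomial z) => // a y py IH; rewrite rmorphD rmorphM rmorph_nat.
move=> /H[/dvdnP[q ->] /IH ->].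
by rewrite natrM kclass_natN !mulr0 addr0.
Qed.

End PolynomialClasses.
End Model.

(** * Polynomials over [Z/NZ] and the isomorphism *)

Lemma polyZmod_natN N : (0 < N)%N -> N%:R = 0 :> polyZmod N.
Proof.
case: N => [//|[_|n _]]; first exact: trivial_ringP.
by rewrite /= -polyC_natr pchar_Zp.
Qed.

(** Every coefficient is the image of a natural number, so polynomials are generated by the same
    steps as [is_polynomial]; surjectivity is proved along them. *)
Lemma polyZmod_ind N (P : polyZmod N -> Prop) : (0 < N)%N -> P 0 ->
  (forall (a : nat) r, P r -> P (a%:R + polyZmodX N * r)) -> forall p, P p.
Proof.
case: N P => [//|[|n]] P _ P0 PS.
  by move=> p; rewrite (trivial_ringP p 0).
elim/poly_ind => // p a Pp; have := PS a p Pp.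
by rewrite addrC /= -commr_polyX -polyC_natr natr_Zp.
Qed.

(** For [N > 1], the constant coefficient and the higher ones give the two conclusions. This is the
    freeness that [Euler_morphism_inj] requires. *)
Lemma polyZmodX_free N (a : nat) (r : polyZmod N) : (0 < N)%N ->
  a%:R + polyZmodX N * r = 0 -> (N %| a)%N /\ r = 0.
Proof.
case: N r => [//|[|n]] r _; first by rewrite dvd1n (trivial_ringP r 0).
rewrite /= -commr_polyX -polyC_natr => /polyP E; split.
  have := E 0%N; rewrite coefD coefC coefMX coef0 /= addr0.
  by move/(congr1 val); rewrite /= val_Zp_nat //= => /eqP.
by apply/polyP => i; have := E i.+1; rewrite coefD coefC coefMX !coef0 /= add0r.
Qed.

Theorem theorem1p4 (N : nat) (hN : (0 < N)%N) (M : structure unary_lang)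
    (hM : model M (theory_T N)) :
  exists phi : {rmorphism K0 (model_T_nontrivial hM) -> polyZmod N},
    bijective phi /\ phi (K0_class _ (dpower M 1)) = polyZmodX N.
Proof.
have [f_inj [c c_bij] f_acyc] := (model_TP M N).1 hM.
have [m0] := Defs.nonempty M.
have [phi phiX] := Euler_morphism f_inj c_bij f_acyc
  (model_T_nontrivial hM) m0 (polyZmodX N) (polyZmod_natN hN).
exists phi; split; last by rewrite -phiX -kclassE.
have inj : injective phi.
  apply: (Euler_morphism_inj f_inj c_bij f_acyc m0 hN) => a r.
  by rewrite phiX; exact: polyZmodX_free.
(* A preimage is built coefficient by coefficient, as [KX] is sent to [X]; injectivity then makes
   the chosen section [g] a two-sided inverse. *)
have /choice[g gK] : forall p, exists z, phi z = p.
  apply: (polyZmod_ind hN); first by exists 0; rewrite rmorph0.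
  move=> a r [z zr]; exists (a%:R + KX (model_T_nontrivial hM) * z).
  by rewrite rmorphD rmorphM rmorph_nat phiX zr.
by exists g => // z; apply: inj; rewrite gK.
Qed.
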